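(* Let $n\equiv0\pmod 3$ and $N=\binom n2$. Let $0<p<1$ be a real (depending on $n$) and $0<m<N$ an integer satisfying $m=pN$ and $\liminf_{n\to\infty}p(n)>0$. Let $X_n$ denote the number of subgraphs (of $\mathcal G(n,m)$ or $\mathcal G(n,p)$) that are isomorphic to a set of $n/3$ vertex disjoint triangles. Let $\mu_n=\mathbf E_{\mathcal G(n,m)}X_n$ and $\lambda_n=\mathbf E_{\mathcal G(n,p)}X_n$. Then $X_n/\mu_n\xrightarrow{p}1$ in $\mathcal G(n,m)$. Assume further that $\limsup_{n\to\infty}p(n)<1$; then $$\frac{\ln\bigl(e^{\beta_n^2/2}X_n/\lambda_n\bigr)}{\beta_n}\xrightarrow{d}\mathcal N(0,1)\quad\text{in }\mathcal G(n,p),$$ where $\beta_n=\sqrt{2(1-p)/p}$.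
   Context: $\mathcal G(n,m)$ is the uniformly random graph on vertex set $[n]$ with exactly $m$ edges; $\mathcal G(n,p)$ is the binomial random graph on $[n]$ with edge probability $p$. Limits are as $n\to\infty$ along multiples of $3$. $\mathcal N(0,1)$ is the standard normal distribution; $\xrightarrow{p}$, $\xrightarrow{d}$ denote convergence in probability and in distribution. *)

(* Defs.v *)
From HB Require Import structures.
From mathcomp Require Import all_boot all_order all_algebra.
From mathcomp Require Import perm.
From mathcomp Require Import all_classical all_reals all_analysis.

Set Implicit Arguments.
Unset Strict Implicit.
Unset Printing Implicit Defensive.
Import Order.TTheory GRing.Theory Num.Theory.
Import numFieldNormedType.Exports.
Local Open Scope classical_set_scope.
Local Open Scope ring_scope.

Definition edge (n : nat) := {e : {set 'I_n} | #|e| == 2}.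

Definition graph (n : nat) := {set edge n}.

Definition adj (n : nat) (G : graph n) : rel 'I_n :=
  fun x y => [exists e in G, val e == [set x; y]%SET].

(* When 3 divides n, this is the adjacency relation of n/3 vertex disjoint
   triangles: {0,1,2}, {3,4,5}, and so on. *)
Definition triangles_adj (n : nat) : rel 'I_n :=
  fun x y => (x != y) && (x %/ 3 == y %/ 3)%N.

Definition rel_iso (n : nat) (r r' : rel 'I_n) : bool :=
  [exists s : {perm 'I_n}, [forall x, forall y, r x y == r' (s x) (s y)]].

(* The number of subgraphs of G isomorphic to n/3 vertex disjoint triangles;
   for n divisible by 3 such a subgraph is spanning, hence it is determined by
   its edge set F. *)
Definition triangle_factors (n : nat) (G : graph n) : nat :=
  #|[set F : graph n | (F \subset G) && rel_iso (adj F) (@triangles_adj n)]%SET|.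

(* A probability on a finite sample space T is given by its mass function. *)
Section finite_probability.
Context {R : realType} {T : finType}.
Implicit Type P : T -> R.

Definition is_dist P : Prop := (forall w, 0 <= P w) /\ \sum_w P w = 1.

Definition Pr P (A : pred T) : R := \sum_(w | A w) P w.

Definition Ex P (X : T -> R) : R := \sum_w P w * X w.

End finite_probability.

Definition gnm {R : realType} (n m : nat) (G : graph n) : R :=
  if #|G| == m then #|[set H : graph n | #|H| == m]%SET|%:R^-1 else 0.

Definition gnp {R : realType} (n : nat) (p : R) (G : graph n) : R :=
  \prod_(e : edge n) (if e \in G then p else 1 - p).

Lemma card_edge n : #|{: edge n}| = 'C(n, 2).
Proof.
rewrite card_sig -[n in RHS]card_ord -card_draws cardsE.
by apply: eq_card => e; rewrite !inE.
Qed.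

Lemma gnm_dist (R : realType) n m : (m <= 'C(n, 2))%N ->
  is_dist (@gnm R n m).
Proof.
move=> mN; split=> [G|]; first by rewrite /gnm; case: ifP; rewrite ?invr_ge0.
rewrite /gnm -big_mkcond /= sumr_const -cardsE -[LHS]mulr_natr mulVf//.
by rewrite pnatr_eq0 card_draws card_edge -lt0n bin_gt0.
Qed.

Lemma gnp_dist (R : realType) n (p : R) : 0 <= p <= 1 -> is_dist (@gnp R n p).
Proof.
move=> /andP[p0 p1]; split=> [G|].
  by apply: prodr_ge0 => e _; case: ifP; rewrite ?subr_ge0.
rewrite /gnp.
rewrite (reindex (fun f : {ffun edge n -> bool} => [set e | f e]%SET)) /=; last first.
  exists (fun G : graph n => [ffun e => e \in G]) => [f _|G _].
    by apply/ffunP => e; rewrite ffunE inE.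
  by apply/setP => e; rewrite inE ffunE.
transitivity (\sum_(f : {ffun edge n -> bool})
    \prod_e (if f e then p else 1 - p)).
  by apply: eq_bigr => f _; apply: eq_bigr => e _; rewrite inE.
rewrite -(bigA_distr_bigA (fun _ b => if b then p else 1 - p)) /=.
by apply: big1 => e _; rewrite big_bool /= addrC subrK.
Qed.

Definition mult3_oo : set_system nat := within [set n | (3 %| n)%N] \oo.

Definition cvg_in_prob {R : realType} (F : set_system nat) (T : nat -> finType)
    (P : forall n, T n -> R) (Y : forall n, T n -> R) (c : R) : Prop :=
  forall eps : R, 0 < eps ->
    Pr (P n) [pred w | eps < `|Y n w - c|] @[n --> F] --> 0.

(* The variables Y n may take infinite values (here: the logarithm of 0); since
   the limit L is a probability on R, pointwise convergence of the distribution
   functions forces the mass escaping to infinity to vanish. *)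
Definition cvg_in_dist {R : realType} (F : set_system nat) (T : nat -> finType)
    (P : forall n, T n -> R) (Y : forall n, T n -> \bar R)
    (L : probability (measurableTypeR R) R) : Prop :=
  forall x : R, {for x, continuous (fun t : R => L [set` `]-oo, t]])} ->
    (Pr (P n) [pred w | (Y n w <= x%:E)%E])%:E @[n --> F] --> L [set` `]-oo, x]].

Definition X_ {R : realType} (n : nat) (G : graph n) : R :=
  (triangle_factors G)%:R.

Definition mu_ (R : realType) (m : nat -> nat) (n : nat) : R :=
  Ex (@gnm R n (m n)) (@X_ R n).

Definition lambda_ {R : realType} (p : nat -> R) (n : nat) : R :=
  Ex (@gnp R n (p n)) (@X_ R n).

Definition beta_ {R : realType} (p : nat -> R) (n : nat) : R :=
  Num.sqrt (2 * (1 - p n) / p n).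

(* Main.v *)
Require Import Defs.
From HB Require Import structures.
From mathcomp Require Import all_boot all_order all_algebra.
From mathcomp Require Import fingroup perm zify ring lra.
From mathcomp Require Import reals.
Import Order.TTheory GRing.Theory Num.Theory.
Set Implicit Arguments.
Unset Strict Implicit.
Unset Printing Implicit Defensive.
Local Open Scope ring_scope.

(** A triangle factor is a partition of the vertex set into triples; for n = 3 t
    there are tau(t) = [triple_partition_number t] of them, each with n edges.
    Write N = 'C(n, 2).

    In G(n,m) a given set of k edges is present with probability
    rho(k) = [incl_prob N m k], so E X = tau(t) rho(n), and E X^2 is the sum of
    rho(2 n - k) over the pairs of factors, k being the number of edges that the
    two factors share. Put d = (N - m) / m. Drawing edges without replacement
    gives rho(2 n - k) <= rho(n)^2 exp(- n^2 d / N) z^k with z close to 1 + d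
    ([incl_prob_overlap]), and n^2 / N >= 2. On the other hand the number k of
    common edges of two random factors is asymptotically Poisson of mean 2, so
    that the mean of z^k is at most exp(2 (z - 1)) + o(1) = exp(2 d) + o(1). The
    two exponentials cancel: E X^2 <= (1 + o(1)) (E X)^2, uniformly in m >= a N
    ([second_moment_uniform]), and Chebyshev's inequality gives the first
    assertion.

    The bound on the mean of z^k rests on one observation: at most one block of a
    partition P shares an edge with a given triple B, so z to the number of edges
    shared by B and P is 1 plus the sum of z^(...) - 1 over the blocks of P
    ([prod_common_pairs]). Expanding the product of these expressions over the
    blocks B of a fixed partition, one block at a time, every expanded block costs
    at most C = [overlap_cost z n] and removes three points from the vertex set
    ([overlap_sum_cons]). This bounds the sum of z^k over all partitions by the
    sum over s of 'C(t, s) C^s tau(t - s) ([overlap_sum_le]). Relative to tau(t)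
    the terms with s < M sum to at most an exponential whose exponent is close to
    2 d ([overlap_exponent_le]), and the others are dominated by the tail of an
    exponential series.

    For the second assertion let m be the number of edges of G(n,p) and w its
    standardized value. Given m the graph is G(n,m); with mu(m) the mean of X in
    G(n,m), one has X / lambda = (X / mu(m)) (mu(m) / lambda). The first factor is
    close to 1 by the uniform version of the first assertion. The second one is
    rho(n) / p^n, whose logarithm is beta w - beta^2 / 2 + o(1) uniformly for
    bounded w ([log_incl_prob_ratio]). Hence the normalized logarithm of X is
    w + o(1) in probability ([log_factors_close_to_edges]), and w is asymptotically
    normal by a version of the theorem of de Moivre and Laplace that is uniform in
    p ([de_moivre_laplace]). The latter is obtained without Stirling's formula:
    the ratios of consecutive binomial probabilities agree with those of the
    normal density up to a factor exp(O(1 / N)) ([binomial_ratio]), so on a window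
    of some standard deviations the binomial probabilities are nearly
    proportional to the normal measures of the corresponding intervals, and the
    constant of proportionality is nearly 1 because both distributions
    charge the complement of a large window very little. *)

(** * Partitions into triples and their overlaps *)

Section triple_partitions.
Local Open Scope set_scope.
Local Open Scope nat_scope.
Context {T : finType}.
Implicit Types (A B : {set T}) (P : {set {set T}}).

Definition triple_partitions A : {set {set {set T}}} :=
  [set P | partition P A && [forall B in P, #|B| == 3]].

Lemma triple_partitionsP A P :
  reflect (partition P A /\ {in P, forall B, #|B| = 3})
    (P \in triple_partitions A).
Proof.
rewrite inE; apply: (iffP andP) => -[PA P3]; split => //.
  by move=> B BP; apply/eqP; move/forall_inP : P3; exact.
by apply/forall_inP => B BP; apply/eqP/P3.
Qed.

Lemma triple_partitions_sub A P B :
  P \in triple_partitions A -> B \in P -> B \subset A.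
Proof.
move=> /triple_partitionsP[/cover_partition <- _] BP.
by rewrite /cover (bigcup_sup B).
Qed.

Lemma triple_partitions_disjoint A P B B' :
  P \in triple_partitions A -> B \in P -> B' \in P -> B != B' ->
  [disjoint B & B'].
Proof.
by move=> /triple_partitionsP[/partition_trivIset /trivIsetP tP _] /tP; apply.
Qed.

Lemma triple_partitionsD1 A P B : P \in triple_partitions A -> B \in P ->
  P :\ B \in triple_partitions (A :\: B).
Proof.
move=> /triple_partitionsP[PA P3] BP; apply/triple_partitionsP; split.
  exact: partitionD1.
by move=> C /setD1P[_ /P3].
Qed.

Lemma triple_partitionsU1 A P B : #|B| = 3 -> B \subset A ->
  P \in triple_partitions (A :\: B) ->
  (B |: P \in triple_partitions A) && (B \notin P).
Proof.
move=> B3 BA /triple_partitionsP[PA P3]; apply/andP; split.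
  apply/triple_partitionsP; split; last by move=> C /setU1P[->|/P3].
  have -> : A = B :|: (A :\: B).
    apply/setP => x; rewrite !inE; case: (boolP (x \in B)) => //= xB.
    exact: (subsetP BA).
  apply: partitionU1 => //; first by rewrite -card_gt0 B3.
  by rewrite -setI_eq0; apply/eqP/setP => x; rewrite !inE; case: (x \in B).
apply/negP => BP; have /card_gt0P[x xB] : 0 < #|B| by rewrite B3.
have : B \subset A :\: B.
  by apply: triple_partitions_sub BP; apply/triple_partitionsP.
by move=> /subsetP/(_ _ xB); rewrite inE xB.
Qed.

(** Removing B is a bijection from the triple partitions of A that contain
    the block B to those of A minus B. *)
Lemma sum_triple_partitions (R : nmodType) A B (f : {set {set T}} -> R) :
  #|B| = 3 -> B \subset A ->
  (\sum_(P in triple_partitions A | B \in P) f P =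
   \sum_(P in triple_partitions (A :\: B)) f (B |: P))%R.
Proof.
move=> B3 BA.
rewrite (reindex_onto (fun P => B |: P) (fun P => P :\ B)) /=; last first.
  by move=> P /andP[_ BP]; rewrite setD1K.
apply: eq_bigl => P; apply/idP/idP.
  move=> /andP[/andP[PA _] /eqP <-].
  by apply: triple_partitionsD1 => //; rewrite setU11.
move=> PA; have /andP[-> BP] := triple_partitionsU1 B3 BA PA.
by rewrite setU11 /= setU1K.
Qed.

Lemma sum_containing_block A P x (f : {set T} -> nat) :
  P \in triple_partitions A -> x \in A ->
  \sum_(B : {set T} | (B \in P) && (x \in B)) f B = f (pblock P x).
Proof.
move=> /triple_partitionsP[PA P3] xA.
have xP : x \in cover P by rewrite (cover_partition PA).
rewrite (big_pred1 (pblock P x)) // => B /=; apply/andP/eqP => [[BP xB]|->].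
  by rewrite (def_pblock (partition_trivIset PA) BP xB).
by rewrite pblock_mem // mem_pblock.
Qed.

Lemma card_triples_containing A x : x \in A ->
  #|[set B : {set T} | [&& x \in B, B \subset A & #|B| == 3]]|
    = 'C(#|A|.-1, 2).
Proof.
move=> xA; have -> : #|A|.-1 = #|A :\ x| by rewrite (cardsD1 x A) xA.
rewrite -cards_draws.
rewrite -[RHS](@card_in_imset _ _ (fun B => x |: B)); last first.
  move=> B B'; rewrite !inE => /andP[BA _] /andP[B'A _] eqB.
  have xN (C : {set T}) : C \subset A :\ x -> x \notin C.
    by move=> CA; apply/negP => xC; have := subsetP CA _ xC; rewrite !inE eqxx.
  by rewrite -(setU1K (xN _ BA)) eqB setU1K // xN.
apply: eq_card => B; rewrite inE; apply/idP/imsetP.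
  move=> /and3P[xB BA B3]; exists (B :\ x); last by rewrite setD1K.
  rewrite inE setSD //=.
  by move: B3; rewrite (cardsD1 x B) xB.
move=> [C]; rewrite inE => /andP[CA /eqP C2] ->.
have xC : x \notin C.
  by apply/negP; move/subsetP : CA => /[apply]; rewrite !inE eqxx.
rewrite setU11 cardsU1 xC C2 /= andbT subUset sub1set xA.
exact: subset_trans CA (subsetDl _ _).
Qed.

End triple_partitions.

Fixpoint triple_partition_number (t : nat) : nat :=
  if t is s.+1 then ('C((3 * s).+2, 2) * triple_partition_number s)%N else 1%N.

Lemma triple_partition_number_gt0 t : (0 < triple_partition_number t)%N.
Proof. by elim: t => //= t IH; rewrite muln_gt0 IH bin_gt0. Qed.

Lemma triple_partitions0 (T : finType) :
  triple_partitions (set0 : {set T}) = [set set0]%SET.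
Proof.
apply/setP => P; rewrite in_set1; apply/triple_partitionsP/eqP.
  by move=> [P0 _]; apply/eqP; rewrite -partition_set0.
by move=> ->; split=> [|B]; rewrite ?partition_set0 ?inE.
Qed.

(** Classify the partitions by the block of a fixed point x: it can be chosen
    in 'C(3 t + 2, 2) ways, and removing it leaves 3 t points. *)
Lemma card_triple_partitions (T : finType) (A : {set T}) t : #|A| = (3 * t)%N ->
  #|triple_partitions A| = triple_partition_number t.
Proof.
elim: t A => [A|t IH A A3].
  by rewrite muln0 => /eqP; rewrite cards_eq0 => /eqP ->; rewrite triple_partitions0 cards1.
have /card_gt0P[x xA] : (0 < #|A|)%N by rewrite A3.
have -> : #|triple_partitions A| = (\sum_(P in triple_partitions A)
    \sum_(B : {set T} | (B \in P) && (x \in B)) 1)%N.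
  rewrite -sum1_card; apply: eq_bigr => P PA.
  by rewrite (@sum_containing_block _ A P x (fun=> 1%N)).
rewrite (exchange_big_dep (fun B : {set T} => [&& x \in B, B \subset A & #|B| == 3])) /=; last first.
  move=> P B PA /andP[BP ->]; rewrite (triple_partitions_sub PA BP) /=.
  by have /triple_partitionsP[_ ->] := PA.
transitivity (\sum_(B : {set T} | [&& x \in B, B \subset A & #|B| == 3])
    triple_partition_number t)%N.
  apply: eq_bigr => B /and3P[xB BA /eqP B3].
  transitivity (\sum_(P in triple_partitions A | B \in P) 1)%N.
    by apply: eq_bigl => P; rewrite xB andbT.
  rewrite (@sum_triple_partitions _ nat _ _ (fun=> 1%N)) // sum1_card IH //.
  by rewrite cardsD (setIidPr BA) A3 B3; lia.
rewrite sum_nat_const -cardsE card_triples_containing // A3.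
congr ('C(_, 2) * _)%N; lia.
Qed.

(** The number of edges that the triangles spanned by two triples share: 3 if
    they are equal, 1 if they meet in two points, and 0 otherwise. *)
Definition common_pairs (T : finType) (B B' : {set T}) : nat :=
  'C(#|B :&: B'|, 2).

Section overlap.
Local Open Scope set_scope.
Context {R : realFieldType} {T : finType} (z : R).
Hypothesis z1 : 1 <= z.
Implicit Types (A B : {set T}) (P : {set {set T}}) (H : seq {set T}).

Definition overlap_cost (n : nat) : R := 3%:R * n%:R * (z - 1) + (z ^+ 3 - 1).

Lemma overlap_cost_ge0 n : 0 <= overlap_cost n.
Proof.
rewrite /overlap_cost addr_ge0 ?subr_ge0 ?exprn_ege1 //.
by rewrite !mulr_ge0 ?subr_ge0.
Qed.

(** A triple cannot meet each of two disjoint sets in two points. *)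
Lemma common_pairs_disjoint A P B B1 B2 : #|B| = 3%N ->
  P \in triple_partitions A -> B1 \in P -> B2 \in P -> B1 != B2 ->
  common_pairs B B1 != 0%N -> common_pairs B B2 = 0%N.
Proof.
move=> B3 PA B1P B2P neq; rewrite /common_pairs -lt0n bin_gt0 => B12.
apply: bin_small; rewrite ltnNge; apply/negP => B22.
have dis : [disjoint B :&: B1 & B :&: B2].
  apply: disjointWl (subsetIr _ _) _; apply: disjointWr (subsetIr _ _) _.
  exact: triple_partitions_disjoint PA B1P B2P neq.
have : (#|B :&: B1 :|: B :&: B2| <= 3)%N.
  by rewrite -B3 subset_leq_card // -setIUr subsetIl.
rewrite cardsU; move: dis; rewrite -setI_eq0 => /eqP ->.
by rewrite cards0; lia.
Qed.

(** At most one block of P shares an edge with B, so at most one factor of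
    the product differs from 1. *)
Lemma prod_common_pairs A P B : #|B| = 3%N -> P \in triple_partitions A ->
  \prod_(B' in P) z ^+ common_pairs B B' =
  1 + \sum_(B' in P) (z ^+ common_pairs B B' - 1).
Proof.
move=> B3 PA.
have [/exists_inP[B1 B1P nz]|/exists_inPn none] :=
    boolP [exists B1 in P, common_pairs B B1 != 0%N].
  have z0 B' : (B' \in P) && (B' != B1) -> common_pairs B B' = 0%N.
    by rewrite eq_sym => /andP[B'P neq]; exact: (common_pairs_disjoint B3 PA B1P B'P neq nz).
  rewrite (bigD1 B1) //= big1 => [|B' /z0 -> //].
  rewrite (bigD1 B1) //= big1 => [|B' /z0 ->]; last by rewrite subrr.
  by rewrite mulr1 addr0 addrC subrK.
rewrite !big1 ?addr0 // => B' /none; rewrite negbK => /eqP -> //.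
by rewrite subrr.
Qed.

(** Only B itself shares three edges with B, and a triple that shares exactly
    one edge with B is given by two of the three points of B and a third
    point. *)
Lemma sum_overlap_cost B : #|B| = 3%N ->
  \sum_(B' : {set T} | #|B'| == 3%N) (z ^+ common_pairs B B' - 1)
    <= overlap_cost #|T|.
Proof.
move=> B3; rewrite (bigD1 B) ?B3 //= /common_pairs setIid B3 [leLHS]addrC.
rewrite /overlap_cost lerD2r.
rewrite (bigID (fun B' : {set T} => #|B :&: B'| == 2%N)) /= [X in _ + X]big1 ?addr0; last first.
  move=> B' /andP[/andP[/eqP B'3 neq] n2].
  rewrite bin_small ?expr0 ?subrr //.
  have : (#|B :&: B'| <= 3)%N by rewrite -B3 subset_leq_card ?subsetIl.
  rewrite leq_eqVlt => /orP[/eqP eq3|]; last by move: n2; lia.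
  have /eqP e1 : B :&: B' == B by rewrite eqEcard subsetIl eq3 B3.
  have /eqP e2 : B :&: B' == B' by rewrite eqEcard subsetIr eq3 B'3.
  by move: neq; rewrite -e2 e1 eqxx.
rewrite (eq_bigr (fun=> z - 1)); last by move=> B' /andP[_ /eqP ->].
rewrite sumr_const -[leLHS]mulr_natl ler_wpM2r ?subr_ge0 // -natrM ler_nat.
rewrite -cardsE.
rewrite -(@card_in_imset _ _ (fun B' => (B :&: B', B' :\: B))); last first.
  by move=> B1 B2 _ _ [e1 e2]; rewrite -[B1](setID _ B) -[B2](setID _ B) e2 [B1 :&: B]setIC e1 setIC.
have -> : (3 * #|T| = #|setX [set E : {set T} | E \subset B & #|E| == 2%N]
    [set E : {set T} | E \subset setT & #|E| == 1%N]|)%N.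
  by rewrite cardsX !cards_draws B3 cardsT bin1.
apply/subset_leq_card/subsetP => _ /imsetP[B' + ->].
rewrite !inE => /andP[/andP[/eqP B'3 _] B2].
rewrite subsetIl subsetT B2 /= cardsD setIC (eqP B2).
by rewrite B'3.
Qed.

Definition overlap_sum H A : R := \sum_(P in triple_partitions A)
  \prod_(B <- H) \prod_(B' in P) z ^+ common_pairs B B'.

(** Expand the factor of B by prod_common_pairs. A triple B' that shares an
    edge with B has at most one point outside B, so it shares no edge with a
    triple disjoint from B: in the remaining product the block B' contributes
    a factor 1, and what is left is an overlap sum over the partitions of A
    minus B'. *)
Lemma overlap_sum_cons H B A : #|B| = 3%N -> {in H, forall B', [disjoint B & B']} ->
   {in H, forall B', #|B'| = 3%N} ->
  overlap_sum (B :: H) A = overlap_sum H A +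
    \sum_(B' : {set T} | (B' \subset A) && (#|B'| == 3%N))
       (z ^+ common_pairs B B' - 1) * overlap_sum H (A :\: B').
Proof.
move=> B3 dis H3; rewrite /overlap_sum.
under eq_bigr => P PA do rewrite big_cons (prod_common_pairs B3 PA) mulrDl mul1r mulr_suml.
rewrite big_split /=; congr (_ + _).
rewrite (exchange_big_dep (fun B' : {set T} => (B' \subset A) && (#|B'| == 3%N))) /=; last first.
  move=> P B' PA B'P; rewrite (triple_partitions_sub PA B'P) /=.
  by have /triple_partitionsP[_ ->] := PA.
apply: eq_bigr => B' /andP[B'A /eqP B'3].
rewrite -mulr_sumr.
have [->|nz] := eqVneq (common_pairs B B') 0%N; first by rewrite subrr !mul0r.
congr (_ * _); rewrite sum_triple_partitions //; apply: eq_bigr => P PA.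
have /andP[PA' B'P] := triple_partitionsU1 B'3 B'A PA.
apply: eq_big_seq => B1 B1H; rewrite big_setU1 //=.
suff -> : common_pairs B1 B' = 0%N by rewrite expr0 mul1r.
move: nz; rewrite /common_pairs -lt0n bin_gt0 => B2; apply: bin_small.
rewrite ltnNge; apply/negP => B12.
have : (#|(B :&: B') :|: (B1 :&: B')| <= 3)%N.
  by rewrite -B'3 subset_leq_card // -setIUl subsetIr.
have : [disjoint B :&: B' & B1 :&: B'].
  apply: disjointWl (subsetIl _ _) _; apply: disjointWr (subsetIl _ _) _.
  exact: dis.
by rewrite cardsU -setI_eq0 => /eqP ->; rewrite cards0; lia.
Qed.

(** The solution of the recursion that overlap_sum_cons gives when every
    expanded block costs C; see overlap_boundS, which is Pascal's rule. *)
Definition overlap_bound (C : R) (h t : nat) : R :=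
  \sum_(s < t.+1) ('C(h, s) * triple_partition_number (t - s))%:R * C ^+ s.

Lemma overlap_boundS C h t : overlap_bound C h.+1 t.+1 =
  overlap_bound C h t.+1 + C * overlap_bound C h t.
Proof.
rewrite /overlap_bound big_ord_recl [in RHS]big_ord_recl /= !bin0 -addrA.
congr (_ + _); rewrite mulr_sumr -big_split /=; apply: eq_bigr => s _.
by rewrite /bump /= add1n binS mulnDl natrD mulrDl exprS; congr (_ + _); ring.
Qed.

Lemma overlap_bound_S0 C h : overlap_bound C h.+1 0 = overlap_bound C h 0.
Proof. by rewrite /overlap_bound !big_ord1 !bin0. Qed.

Lemma overlap_sum_le H A t : {in H, forall B, #|B| = 3%N} ->
  pairwise (fun B B' : {set T} => [disjoint B & B']) H -> #|A| = (3 * t)%N ->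
  overlap_sum H A <= overlap_bound (overlap_cost #|T|) (size H) t.
Proof.
elim: H A t => [|B H IH] A t H3 dis A3.
  rewrite /overlap_sum; under eq_bigr do rewrite big_nil.
  rewrite sumr_const (card_triple_partitions A3) /overlap_bound big_ord_recl /=.
  rewrite bin0 mul1n subn0 expr0 mulr1 big1 ?addr0 // => s _.
  by rewrite bin0n mul0n mul0r.
have B3 : #|B| = 3%N by apply: H3; rewrite mem_head.
have H3' : {in H, forall B', #|B'| = 3%N} by move=> B' B'H; apply: H3; rewrite inE B'H orbT.
move: dis; rewrite pairwise_cons => /andP[/allP dis1 dis].
rewrite overlap_sum_cons //.
case: t A3 => [|t] A3.
  rewrite big_pred0 ?addr0; first by rewrite overlap_bound_S0; apply: IH.
  move=> B'; apply/negP => /andP[/subset_leq_card B'A /eqP B'3].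
  by move: B'A; rewrite B'3 A3.
rewrite overlap_boundS lerD ?IH //.
apply: (@le_trans _ _ (\sum_(B' : {set T} | (B' \subset A) && (#|B'| == 3%N))
    (z ^+ common_pairs B B' - 1) * overlap_bound (overlap_cost #|T|) (size H) t)).
  apply: ler_sum => B' /andP[B'A /eqP B'3].
  rewrite ler_wpM2l ?subr_ge0 ?exprn_ege1 // IH //.
  by rewrite cardsD (setIidPr B'A) A3 B'3; lia.
rewrite -mulr_suml ler_wpM2r //.
  by rewrite sumr_ge0 // => s _; rewrite mulr_ge0 ?exprn_ge0 ?overlap_cost_ge0.
apply: le_trans (sum_overlap_cost B3).
rewrite [leRHS](bigID (fun B' : {set T} => B' \subset A)) /= ler_wpDr //.
  by rewrite sumr_ge0 // => B' _; rewrite subr_ge0 exprn_ege1.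
by rewrite le_eqVlt; apply/orP; left; apply/eqP; apply: eq_bigl => B'; rewrite andbC.
Qed.
End overlap.

(** * Triangle factors as partitions into triples *)

Section partition_graph.
Local Open Scope set_scope.
Local Open Scope nat_scope.
Context {n : nat}.
Implicit Types (P : {set {set 'I_n}}) (F : graph n) (e : edge n).

Definition partition_graph P : graph n :=
  [set e : edge n | [exists B in P, val e \subset B]].

Lemma sum_blocks_containing_edge A P e : P \in triple_partitions A ->
  \sum_(B in P) (val e \subset B) = (e \in partition_graph P).
Proof.
move=> PA; rewrite inE; case: (boolP [exists B in P, _]) => [/exists_inP[B BP eB]|/exists_inPn no].
  rewrite (bigD1 B) //= eB big1 // => B' /andP[B'P neq]; apply/eqP; rewrite eqb0.
  apply/negP => eB'; have := triple_partitions_disjoint PA B'P BP neq.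
  rewrite -setI_eq0 => /eqP dis.
  have : val e \subset B' :&: B by rewrite subsetI eB' eB.
  by rewrite dis subset0 -cards_eq0 (eqP (valP e)).
by rewrite big1 // => B /no /negbTE ->.
Qed.

Lemma card_edges_in (A : {set 'I_n}) : \sum_(e : edge n) (val e \subset A) = 'C(#|A|, 2).
Proof.
rewrite -cards_draws -[LHS]big_mkcond /= sum1_card -cardsE.
rewrite -(card_imset _ val_inj); apply: eq_card => E; rewrite inE.
apply/imsetP/andP => [[e + ->]|[EA E2]].
  by rewrite inE => eA; split => //; exact: (valP e).
by exists (exist _ E E2 : edge n); first rewrite inE.
Qed.

(** Every edge of a partition graph lies in exactly one block, so the common
    edges can be counted block by block. *)
Lemma card_partition_graphI A A' P P' :
  P \in triple_partitions A -> P' \in triple_partitions A' ->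
  #|partition_graph P :&: partition_graph P'| =
    \sum_(B in P) \sum_(B' in P') common_pairs B B'.
Proof.
move=> PA PA'.
transitivity (\sum_(e : edge n) (\sum_(B in P) (val e \subset B)) * (\sum_(B' in P') (val e \subset B'))).
  rewrite -sum1_card big_mkcond; apply: eq_bigr => e _.
  rewrite (sum_blocks_containing_edge _ PA) (sum_blocks_containing_edge _ PA') inE.
  by case: (e \in partition_graph P); case: (e \in partition_graph P').
under [LHS]eq_bigr => e _ do rewrite big_distrl.
under [LHS]eq_bigr => e _ do under eq_bigr => B _ do rewrite big_distrr.
rewrite exchange_big; apply: eq_bigr => B BP /=.
rewrite exchange_big; apply: eq_bigr => B' B'P /=.
rewrite /common_pairs -card_edges_in; apply: eq_bigr => e _.
by rewrite subsetI; case: (_ \subset _); case: (_ \subset _).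
Qed.

Lemma card_partition_graph A P : P \in triple_partitions A ->
  #|partition_graph P| = #|A|.
Proof.
move=> PA; rewrite -[partition_graph P]setIid (card_partition_graphI PA PA).
have /triple_partitionsP[part P3] := PA.
rewrite (card_partition part); apply: eq_bigr => B BP.
rewrite (bigD1 B) //= big1 ?addn0; first by rewrite /common_pairs setIid P3.
move=> B' /andP[B'P neq]; have := triple_partitions_disjoint PA B'P BP neq.
by rewrite /common_pairs setIC -setI_eq0 => /eqP ->; rewrite cards0.
Qed.

Lemma adj_partition_graph P x y : P \in triple_partitions setT ->
  adj (partition_graph P) x y = (x != y) && (y \in pblock P x).
Proof.
move=> PT; have /triple_partitionsP[part P3] := PT.
have xP z : z \in cover P by rewrite (cover_partition part) inE.
apply/exists_inP/andP => [[e + /eqP exy]|[neq yx]].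
  rewrite inE => /exists_inP[B BP eB]; split.
    by apply/negP => /eqP exy'; have := valP e; rewrite /= exy exy' setUid cards1.
  move: eB; rewrite exy subUset !sub1set => /andP[xB yB].
  by rewrite (def_pblock (partition_trivIset part) BP xB).
have e2 : #|[set x; y]| == 2 by rewrite cards2 neq.
exists (exist _ [set x; y] e2 : edge n); last exact: eqxx.
rewrite inE; apply/exists_inP; exists (pblock P x); first by rewrite pblock_mem.
by rewrite subUset !sub1set yx mem_pblock xP.
Qed.

(** The block of x consists of x and its neighbours, so the graph determines
    the partition. *)
Lemma partition_graph_inj :
  {in triple_partitions [set: 'I_n] &, injective partition_graph}.
Proof.
move=> P P' PT PT' eqg.
have pb x y : (y \in pblock P x) = (y \in pblock P' x).
  have [->|neq] := eqVneq x y.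
    rewrite !mem_pblock.
    have /triple_partitionsP[/cover_partition -> _] := PT.
    by have /triple_partitionsP[/cover_partition -> _] := PT'.
  have := adj_partition_graph x y PT; rewrite eqg adj_partition_graph //.
  by rewrite neq.
have /triple_partitionsP[part _] := PT; have /triple_partitionsP[part' _] := PT'.
rewrite -(equivalence_partition_pblock part) -(equivalence_partition_pblock part').
apply: eq_in_imset => x _; apply/setP => y; rewrite !inE /=.
by rewrite pb.
Qed.

Lemma adj_edge F e x y : val e = [set x; y] -> adj F x y = (e \in F).
Proof.
move=> exy; apply/exists_inP/idP => [[e' e'F /eqP e'xy]|eF].
  suff <- : e' = e by [].
  by apply: val_inj; rewrite /= e'xy exy.
by exists e; rewrite // exy.
Qed.

Lemma eq_adj F F' : adj F =2 adj F' -> F = F'.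
Proof.
move=> FF'; apply/setP => e; have /cards2P[x [y [_ exy]]] := valP e.
by rewrite -!(adj_edge _ exy).
Qed.

End partition_graph.

Section triangle_factors_as_partitions.
Local Open Scope set_scope.
Local Open Scope nat_scope.
Context {t : nat}.
Let n := (3 * t)%N.
Implicit Types (P : {set {set 'I_n}}) (F : graph n).

Lemma card_ord_div3 (q : 'I_n) : #|[set i : 'I_n | i %/ 3 == q %/ 3]| = 3.
Proof.
have q3 : (q %/ 3 < t) by have := ltn_ord q; rewrite /n; lia.
have lt3 (j : 'I_3) : (q %/ 3 * 3 + j < n).
  by have := ltn_ord j; rewrite /n; lia.
rewrite -[RHS]card_ord -(@card_imset _ _ (fun j : 'I_3 => Ordinal (lt3 j))); last first.
  by move=> i j /(congr1 val) /= /addnI /val_inj.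
apply: eq_card => i; rewrite inE; apply/eqP/imsetP => [e|[j _ ->]] /=.
  have i3 : (i %% 3 < 3) by rewrite ltn_mod.
  by exists (Ordinal i3) => //; apply: val_inj => /=; rewrite -e -divn_eq.
by rewrite divnMDl // (divn_small (ltn_ord j)) addn0.
Qed.

(** The blocks are the preimages under s of the blocks 3 q, 3 q + 1, 3 q + 2
    of the reference graph. *)
Lemma partition_of_iso F : rel_iso (adj F) (@triangles_adj n) ->
  exists2 P, P \in triple_partitions setT & F = partition_graph P.
Proof.
move=> /existsP[s /forallP sF].
pose r := fun x y : 'I_n => s x %/ 3 == s y %/ 3.
have eqr : {in [set: 'I_n] & &, equivalence_rel r}.
  by move=> x y z _ _ _; rewrite /r; split => // /eqP ->.
have PT : equivalence_partition r setT \in triple_partitions setT.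
  apply/triple_partitionsP; split; first exact: equivalence_partitionP.
  move=> _ /imsetP[x _ ->].
  rewrite -(card_ord_div3 (s x)) -[LHS](card_imset _ (@perm_inj _ s)).
  apply: eq_card => i; rewrite inE; apply/imsetP/eqP => [[y]|e].
    by rewrite !inE /= /r => /eqP -> ->.
  by exists ((s^-1)%g i); rewrite ?permKV // !inE /= /r permKV e.
exists (equivalence_partition r setT) => //.
apply: eq_adj => x y; rewrite (adj_partition_graph _ _ PT).
rewrite (pblock_equivalence_partition eqr) ?inE //.
move/forallP : (sF x) => /(_ y) /eqP ->.
by rewrite /triangles_adj (inj_eq perm_inj).
Qed.

(** Number the blocks from 0 to t - 1 and the points of each block from 0 to
    2; the permutation sends the point of number r in the block of number q
    to 3 q + r. *)
Lemma iso_of_partition P : P \in triple_partitions setT ->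
  rel_iso (adj (partition_graph P)) (@triangles_adj n).
Proof.
move=> PT; have /triple_partitionsP[part P3] := PT.
have xP z : z \in cover P by rewrite (cover_partition part) inE.
have cP : #|P| = t.
  have := card_uniform_partition P3 part; rewrite cardsT card_ord /n; lia.
pose blk x := index (pblock P x) (enum P).
pose pos x := index x (enum (pblock P x)).
have blk_lt x : blk x < t.
  by rewrite -cP cardE index_mem mem_enum pblock_mem.
have pos_lt x : pos x < 3.
  by rewrite -(P3 (pblock P x)) ?pblock_mem // cardE index_mem mem_enum mem_pblock.
have f_lt x : blk x * 3 + pos x < n.
  by have := blk_lt x; have := pos_lt x; rewrite /n; lia.
pose f x := Ordinal (f_lt x).
have fdiv x : f x %/ 3 = blk x by rewrite /= divnMDl // (divn_small (pos_lt x)) addn0.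
have blkE x y : (blk x == blk y) = (y \in pblock P x).
  apply/eqP/idP => [e|/(same_pblock (partition_trivIset part)) e].
    have -> : pblock P x = pblock P y.
      by apply: (index_inj set0 _ _ (s := enum P)) => //; rewrite mem_enum pblock_mem.
    by rewrite mem_pblock.
  by rewrite /blk e.
have f_inj : injective f.
  move=> x y exy; have eb : blk x = blk y by rewrite -!fdiv exy.
  have ep : pos x = pos y by have := congr1 val exy; rewrite /= eb => /addnI.
  have epb : pblock P x = pblock P y.
    by apply: (index_inj set0 _ _ (s := enum P)) => //; rewrite mem_enum pblock_mem.
  move: ep; rewrite /pos epb; apply: (index_inj x); rewrite mem_enum ?mem_pblock //.
  by rewrite -epb mem_pblock.
apply/existsP; exists (perm f_inj); apply/forallP => x; apply/forallP => y.
rewrite adj_partition_graph // /triangles_adj (inj_eq perm_inj) !permE !fdiv.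
by rewrite blkE.
Qed.

Lemma triangle_factorsE (G : graph n) : triangle_factors G =
  \sum_(P in triple_partitions [set: 'I_n]) (partition_graph P \subset G).
Proof.
rewrite -big_mkcondr /= sum1_card.
rewrite -(@card_in_imset _ _ partition_graph); last first.
  by move=> P P'; rewrite !unfold_in => /andP[PT _] /andP[PT' _]; exact: partition_graph_inj.
apply: eq_card => F; rewrite inE; apply/andP/imsetP => [[FG /partition_of_iso[P PT FE]]|[P + ->]].
  by exists P; rewrite // unfold_in /= PT -FE.
by rewrite unfold_in => /andP[PT ->]; rewrite iso_of_partition.
Qed.

End triangle_factors_as_partitions.

(** * Random sets, random graphs and moments of the number of factors *)

Section random_subsets.
Context {R : realFieldType} {T : finType}.
Implicit Types (F G : {set T}) (m k : nat) (p : R).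

Lemma card_supersets F m : (#|F| <= m)%N ->
  #|[set G : {set T} | (F \subset G) && (#|G| == m)]%SET| =
  'C(#|T| - #|F|, m - #|F|).
Proof.
move=> Fm; have -> : (#|T| - #|F| = #|~: F|)%N by rewrite -(cardsC F) addKn.
rewrite -cards_draws.
have dis G : G \subset ~: F -> F :|: G :\: F = F :|: G /\ (F :|: G) :\: F = G.
  move=> GF; split; apply/setP => x; rewrite !inE; case: (boolP (x \in F)) => //= xF.
  by apply/esym/negP => /(subsetP GF); rewrite inE xF.
rewrite -[RHS](@card_in_imset _ _ (fun G => F :|: G)); last first.
  move=> G G'; rewrite !inE => /andP[/dis[_ GF] _] /andP[/dis[_ G'F] _] e.
  by rewrite -GF e G'F.
apply: eq_card => G; rewrite inE; apply/andP/imsetP => [[FG /eqP Gm]|[G' + ->]].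
  exists (G :\: F); last by rewrite -{1}(setIidPr FG) setID.
  by rewrite inE setDE subsetIr /= -setDE cardsD (setIidPr FG) Gm.
rewrite inE => /andP[G'F /eqP Gm]; rewrite subsetUl cardsU Gm; split => //.
move: G'F; rewrite -disjoints_subset -setI_eq0 setIC => /eqP ->.
by rewrite cards0; lia.
Qed.

(** The probability that k given elements belong to a uniformly random
    m-subset of a set of size N; see sum_gnm_incl. *)
Definition incl_prob (N m k : nat) : R :=
  \prod_(j < k) ((m%:R - j%:R) / (N%:R - j%:R)).

Lemma incl_probS N m k : incl_prob N m k.+1 =
  incl_prob N m k * ((m%:R - k%:R) / (N%:R - k%:R)).
Proof. by rewrite /incl_prob big_ord_recr. Qed.

Lemma binB_incl_prob N m k : (m <= N)%N -> (k <= m)%N ->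
  'C(N - k, m - k)%:R = 'C(N, m)%:R * incl_prob N m k.
Proof.
move=> mN; elim: k => [|k IH] km; first by rewrite !subn0 /incl_prob big_ord0 mulr1.
rewrite incl_probS mulrA -IH 1?ltnW //.
rewrite -!natrB 1?ltnW //; last exact: leq_trans km mN.
have kN := leq_trans km mN.
have Nk : (N - k)%:R != 0 :> R by rewrite pnatr_eq0 subn_eq0 -ltnNge.
apply: (mulIf Nk); rewrite -!mulrA mulVf // mulr1 -!natrM; congr _%:R.
have := mul_bin_diag (N - k) (m - k.+1).
have -> : ((m - k.+1).+1 = m - k)%N by lia.
by rewrite (subnS N k) mulnC => ->; rewrite mulnC.
Qed.

Lemma incl_prob0 N m k : (m < k)%N -> incl_prob N m k = 0.
Proof.
by move=> mk; rewrite /incl_prob (bigD1 (Ordinal mk)) //= subrr mul0r mul0r.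
Qed.

(** The mass function of a random subset of T that contains each element
    independently with probability p. *)
Definition bernoulli_set p G : R := \prod_e (if e \in G then p else 1 - p).

Lemma bernoulli_setE p G :
  bernoulli_set p G = p ^+ #|G| * (1 - p) ^+ (#|T| - #|G|).
Proof.
rewrite /bernoulli_set (bigID (mem G)) /=.
rewrite (eq_bigr (fun=> p)); last by move=> e ->.
rewrite [X in _ * X](eq_bigr (fun=> 1 - p)); last by move=> e /negbTE ->.
rewrite !prodr_const; congr (_ * _ ^+ _).
by rewrite -(cardsC G) addKn; apply: eq_card => e; rewrite !inE.
Qed.

(** Expand the product over e of p + (1 - p) [e not in F] according to the
    set G of the elements at which p is chosen. *)
Lemma sum_bernoulli_set_incl p F :
  \sum_G bernoulli_set p G * (F \subset G)%:R = p ^+ #|F|.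
Proof.
transitivity (\prod_e (p + (if e \in F then 0 else 1 - p))).
  rewrite bigA_distr; apply: eq_bigr => G _.
  have [FG|] := boolP (F \subset G).
    rewrite mulr1; apply: eq_bigr => e _; case: ifPn => // eG.
    by case: ifPn => // /(subsetP FG); rewrite (negbTE eG).
  move=> /subsetPn[e eF eG]; rewrite mulr0 (bigD1 e) //=.
  by rewrite (negbTE eG) eF mul0r.
rewrite (bigID (mem F)) /= (eq_bigr (fun=> p)); last by move=> e ->; rewrite addr0.
rewrite [X in _ * X]big1 ?mulr1 ?prodr_const // => e /negbTE ->.
by rewrite addrC subrK.
Qed.

Lemma sum_bernoulli_set p : \sum_G bernoulli_set p G = 1.
Proof.
rewrite -[RHS](expr0 p) -(cards0 T) -sum_bernoulli_set_incl.
by apply: eq_bigr => G _; rewrite sub0set mulr1.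
Qed.

Lemma card_sum_mem G : #|G|%:R = \sum_e (e \in G)%:R :> R.
Proof. by rewrite -natr_sum -sum1_card big_mkcond /=; congr _%:R; apply: eq_bigr => e; case: ifP. Qed.

Lemma mean_bernoulli_set p :
  \sum_G bernoulli_set p G * #|G|%:R = #|T|%:R * p.
Proof.
under eq_bigr => G _ do rewrite card_sum_mem mulr_sumr.
rewrite exchange_big /=.
transitivity (\sum_(e : T) p); last by rewrite sumr_const mulr_natl.
apply: eq_bigr => e _; rewrite -[RHS]expr1 -(cards1 e) -sum_bernoulli_set_incl.
by apply: eq_bigr => G _; rewrite sub1set.
Qed.

(** The square of the size of G is the sum over e and e' of the indicator
    that G contains both. *)
Lemma second_moment_bernoulli_set p :
  \sum_G bernoulli_set p G * #|G|%:R ^+ 2 =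
  #|T|%:R * p + #|T|%:R * (#|T|%:R - 1) * p ^+ 2.
Proof.
transitivity (\sum_(e : T) \sum_(e' : T) p ^+ #|[set e; e']|).
  under eq_bigr => G _ do rewrite card_sum_mem expr2 big_distrlr /= mulr_sumr.
  rewrite exchange_big; apply: eq_bigr => e _ /=.
  under eq_bigr => G _ do rewrite mulr_sumr.
  rewrite exchange_big; apply: eq_bigr => e' _ /=.
  rewrite -sum_bernoulli_set_incl; apply: eq_bigr => G _.
  by rewrite subUset !sub1set -natrM mulnb.
transitivity (\sum_(e : T) (p + (#|T|%:R - 1) * p ^+ 2)); last first.
  by rewrite sumr_const -[LHS]mulr_natl mulrDr mulrA.
apply: eq_bigr => e _; rewrite (bigD1 e) //= setUid cards1 expr1; congr (_ + _).
rewrite (eq_bigr (fun=> p ^+ 2)); last by move=> e'; rewrite eq_sym cards2 => ->.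
rewrite sumr_const -[LHS]mulr_natl; congr (_ * _).
have -> : #|[pred e' | e' != e]| = #|T|.-1.
  exact: cardC1.
by rewrite -subn1 natrB //; apply/card_gt0P; exists e.
Qed.

Lemma variance_bernoulli_set p :
  \sum_G bernoulli_set p G * (#|G|%:R - #|T|%:R * p) ^+ 2 =
  #|T|%:R * p * (1 - p).
Proof.
set N := #|T|%:R.
transitivity (\sum_G (bernoulli_set p G * #|G|%:R ^+ 2 -
   (2 * N * p) * (bernoulli_set p G * #|G|%:R) + (N * p) ^+ 2 * bernoulli_set p G)).
  by apply: eq_bigr => G _; ring.
rewrite big_split /= sumrB -!mulr_sumr.
rewrite second_moment_bernoulli_set mean_bernoulli_set sum_bernoulli_set.
by rewrite -/N; ring.
Qed.

Lemma sum_bernoulli_set_card p (f : nat -> R) :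
  \sum_G bernoulli_set p G * f #|G| = \sum_(k < #|T|.+1)
    (p ^+ k * (1 - p) ^+ (#|T| - k) *+ 'C(#|T|, k)) * f k.
Proof.
rewrite (partition_big (fun G : {set T} => inord #|G| : 'I_#|T|.+1) xpredT) //=.
apply: eq_bigr => k _.
have GN (G : {set T}) : (#|G| < #|T|.+1)%N by rewrite ltnS max_card.
rewrite -card_draws mulrnAl -sumr_const; apply: eq_big => G.
  by rewrite inE; apply/eqP/eqP => [<-|Gk]; [rewrite inordK|apply: val_inj; rewrite /= inordK // Gk].
by move=> /eqP <-; rewrite bernoulli_setE inordK.
Qed.

End random_subsets.

Section random_graphs.
Context {R : realType} {n : nat}.
Implicit Types (F G : graph n) (m k : nat) (p : R).
Local Notation N := 'C(n, 2).

Lemma gnmE m G : (m <= N)%N ->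
  gnm m G = (#|G| == m)%:R / 'C(N, m)%:R :> R.
Proof.
by move=> mN; rewrite /gnm card_draws card_edge; case: ifP; rewrite ?mul1r ?mul0r.
Qed.

Lemma sum_gnm_incl m F : (m <= N)%N ->
  \sum_G gnm m G * (F \subset G)%:R = incl_prob N m #|F| :> R.
Proof.
move=> mN; have C0 : 'C(N, m)%:R != 0 :> R by rewrite pnatr_eq0 -lt0n bin_gt0.
transitivity (#|[set G : graph n | (F \subset G) && (#|G| == m)]%SET|%:R / 'C(N, m)%:R : R).
  rewrite -sum1_card natr_sum mulr_suml [RHS]big_mkcond; apply: eq_bigr => G _.
  rewrite gnmE // inE; case: (F \subset G); case: (#|G| == m);
  by rewrite /= ?mulr0 ?mulr1 ?mul0r.
have [Fm|mF] := leqP #|F| m.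
  by rewrite card_supersets // card_edge binB_incl_prob // mulrAC mulfV // mul1r.
rewrite incl_prob0 //; apply/eqP; rewrite mulf_eq0 pnatr_eq0 cards_eq0; apply/orP; left.
apply/eqP/setP => G; rewrite !inE; apply/negP => /andP[/subset_leq_card FG /eqP Gm].
by move: FG; rewrite Gm leqNgt mF.
Qed.

Lemma sum_gnp_card p m :
  \sum_(H : graph n | #|H| == m) gnp p H = p ^+ m * (1 - p) ^+ (N - m) *+ 'C(N, m).
Proof.
rewrite -card_edge -card_draws -sumr_const card_edge.
apply: eq_big => [G|G /eqP Gm]; first by rewrite inE.
by rewrite -[LHS]/(bernoulli_set p G) bernoulli_setE Gm card_edge.
Qed.

(** All graphs with m edges are equally likely in G(n,p), so conditionally on
    its number of edges G(n,p) is a uniformly random graph. *)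
Lemma sum_gnp_by_edges p (f : graph n -> R) :
  \sum_G gnp p G * f G = \sum_(m < N.+1)
    (\sum_(H : graph n | #|H| == m) gnp p H) * (\sum_G gnm m G * f G).
Proof.
rewrite (partition_big (fun G : graph n => inord #|G| : 'I_N.+1) xpredT) //=.
apply: eq_bigr => m _.
have mN : (m <= N)%N by rewrite -ltnS.
have GN G : (#|G| < N.+1)%N by rewrite ltnS -(card_edge n) max_card.
have eqm G : (inord #|G| == m) = (#|G| == m).
  by apply/eqP/eqP => [<-|Gm]; [rewrite inordK|apply: val_inj; rewrite /= inordK // Gm].
under eq_bigl => G do rewrite eqm.
rewrite sum_gnp_card; set q := p ^+ m * _.
have gnpE G : #|G| == m -> gnp p G = q.
  move=> /eqP Gm; rewrite -[LHS]/(bernoulli_set p G).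
  by rewrite bernoulli_setE Gm card_edge.
rewrite (eq_bigr (fun G => q * f G)); last by move=> G /gnpE ->.
rewrite -mulr_sumr -[q *+ _]mulr_natr -mulrA; congr (_ * _).
rewrite mulr_sumr [LHS]big_mkcond; apply: eq_bigr => G _.
rewrite gnmE //; case: eqP => _; last by rewrite !mul0r mulr0.
rewrite mul1r mulrA mulfV ?mul1r // pnatr_eq0 -lt0n bin_gt0 //.
Qed.

Lemma sum_gnp_incl p F : \sum_G gnp p G * (F \subset G)%:R = p ^+ #|F|.
Proof. exact: sum_bernoulli_set_incl. Qed.

End random_graphs.

Lemma chebyshev_finite {R : realType} {T : finType} (P : T -> R) (X : T -> R)
    (c eps : R) : (forall w, 0 <= P w) -> 0 < eps ->
  Pr P [pred w | eps < `|X w - c|] <= (\sum_w P w * (X w - c) ^+ 2) / eps ^+ 2.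
Proof.
move=> P0 e0; rewrite ler_pdivlMr ?exprn_gt0 // /Pr mulr_suml [leLHS]big_mkcond.
apply: ler_sum => w _; case: ifP => [/= ew|_]; last by rewrite mulr_ge0 ?sqr_ge0.
rewrite ler_wpM2l // -[leRHS]real_normK ?num_real // lerXn2r ?nnegrE ?normr_ge0 //; exact: ltW.
Qed.

Section triangle_factor_moments.
Context {R : realType} {t : nat}.
Local Notation n := (3 * t)%N.
Local Notation N := 'C(n, 2).
Local Notation D := (triple_partitions [set: 'I_n]%SET).

Lemma X_sum_partitions (G : graph n) :
  X_ G = \sum_(P in D) (partition_graph P \subset G)%:R :> R.
Proof. by rewrite /X_ triangle_factorsE natr_sum. Qed.

Lemma card_partition_graph_setT P : P \in D -> #|partition_graph P| = n.
Proof. by move/card_partition_graph ->; rewrite cardsT card_ord. Qed.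

Lemma mean_gnm_X m : (m <= N)%N ->
  Ex (@gnm R n m) (@X_ R n) = #|D|%:R * incl_prob N m n.
Proof.
move=> mN; rewrite /Ex; under eq_bigr do rewrite X_sum_partitions mulr_sumr.
rewrite exchange_big /= mulr_natl -sumr_const; apply: eq_bigr => P PD.
by rewrite sum_gnm_incl // card_partition_graph_setT.
Qed.

Lemma mean_gnp_X p :
  Ex (@gnp R n p) (@X_ R n) = #|D|%:R * p ^+ n.
Proof.
rewrite /Ex; under eq_bigr do rewrite X_sum_partitions mulr_sumr.
rewrite exchange_big /= mulr_natl -sumr_const; apply: eq_bigr => P PD.
by rewrite sum_gnp_incl card_partition_graph_setT.
Qed.

(** Two partition graphs are both contained in G exactly when their union is,
    and the union has 2 n minus the number of common edges. *)
Lemma second_moment_gnm_X m : (m <= N)%N ->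
  Ex (@gnm R n m) (fun G => X_ G ^+ 2) = \sum_(P in D) \sum_(P' in D)
    incl_prob N m (2 * n - #|partition_graph P :&: partition_graph P'|).
Proof.
move=> mN; rewrite /Ex; under eq_bigr do rewrite X_sum_partitions expr2 big_distrlr /= mulr_sumr.
rewrite exchange_big /=; apply: eq_bigr => P PD.
under eq_bigr do rewrite mulr_sumr.
rewrite exchange_big /=; apply: eq_bigr => P' P'D.
transitivity (\sum_G gnm m G * (partition_graph P :|: partition_graph P' \subset G)%:R : R).
  by apply: eq_bigr => G _; rewrite subUset -natrM mulnb.
by rewrite sum_gnm_incl // cardsU !card_partition_graph_setT // addnn mul2n.
Qed.

Lemma card_triple_partitions_setT : #|D| = triple_partition_number t.
Proof. by apply: card_triple_partitions; rewrite cardsT card_ord. Qed.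

(** This is overlap_sum_le with the blocks of P as the list of triples. *)
Lemma sum_common_edges_le (z : R) (P : {set {set 'I_n}}) : 1 <= z -> P \in D ->
  \sum_(P' in D) z ^+ #|(partition_graph P :&: partition_graph P')%SET| <=
  overlap_bound (overlap_cost z n) t t.
Proof.
move=> z1 PD; have /triple_partitionsP[part P3] := PD.
have cP : #|P| = t.
  have := card_uniform_partition P3 part; rewrite cardsT card_ord; lia.
have H3 : {in enum P, forall B : {set 'I_n}, #|B| = 3%N}.
  by move=> B; rewrite mem_enum; exact: P3.
have dis : pairwise (fun B B' : {set 'I_n} => [disjoint B & B']) (enum P).
  rewrite -(@eq_in_pairwise _ (mem (enum P)) (fun B B' => B != B')).
  - by rewrite -uniq_pairwise enum_uniq.
  - move=> B B'; rewrite /= !mem_enum => BP B'P; apply/idP/idP => [|dis].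
      exact: triple_partitions_disjoint PD BP B'P.
    apply/eqP => BB'; move: dis; rewrite -BB' -setI_eq0 setIid.
    by rewrite -cards_eq0 P3.
  - exact/allP.
have := @overlap_sum_le R _ z z1 (enum P) [set: 'I_n]%SET t H3 dis.
rewrite cardsT card_ord -cardE cP => /(_ erefl); apply: le_trans.
rewrite le_eqVlt; apply/orP; left; apply/eqP.
apply: eq_bigr => P' P'D; rewrite (card_partition_graphI PD P'D).
rewrite big_enum /= expr_sum; apply: eq_bigr => B BP; by rewrite expr_sum.
Qed.

End triangle_factor_moments.

From mathcomp Require Import all_classical all_reals all_analysis measurable_realfun.
Import numFieldNormedType.Exports.
Local Open Scope classical_set_scope.
Local Open Scope ring_scope.

(** * The second moment in G(n,m) *)

Section inclusion_ratio.
Context {R : realType} (N m n : nat).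
Hypotheses (n0 : (0 < n)%N) (nm : (2 * n <= m)%N) (mN : (m <= N)%N).
Let d : R := (N%:R - m%:R) / m%:R.
Let th : R := (N%:R - m%:R) / (m%:R - n%:R).
Let A (j : nat) : R := (m%:R - j%:R) / (N%:R - j%:R).

Lemma incl_probD (k l : nat) : incl_prob N m (k + l) =
  incl_prob N m k * \prod_(j < l) ((m%:R - (k + j)%:R) / (N%:R - (k + j)%:R)) :> R.
Proof. by rewrite /incl_prob big_split_ord. Qed.

(** The quotient of the two fractions is 1 - n (N - m) / ((m - j) (N - n -
    j)), which is at most 1 - n d / N. *)
Lemma incl_factor_shift j : (j < n)%N ->
  (m%:R - (n + j)%:R) / (N%:R - (n + j)%:R) <= expR (- (n%:R * d / N%:R)) * A j.
Proof.
move=> jn.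
have jR : j%:R + 1 <= n%:R :> R by rewrite natr1 ler_nat.
have j0 : 0 <= j%:R :> R by [].
have nmR : 2 * n%:R <= m%:R :> R by rewrite -natrM ler_nat.
have mNR : m%:R <= N%:R :> R by rewrite ler_nat.
have n1 : 1 <= n%:R :> R by rewrite ler1n.
apply: (@le_trans _ _ ((1 - n%:R * d / N%:R) * A j)); last first.
  by rewrite ler_wpM2r ?expR_ge1Dx // /A divr_ge0 // subr_ge0; lra.
rewrite /A /d natrD.
set mm : R := m%:R in nmR mNR *; set nn : R := n%:R in jR nmR n1 *.
set NN : R := N%:R in mNR *; set jj : R := j%:R in jR j0 *.
have -> : (mm - (nn + jj)) / (NN - (nn + jj)) =
    (1 - nn * (NN - mm) / ((mm - jj) * (NN - (nn + jj)))) * ((mm - jj) / (NN - jj)).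
  by field; rewrite !gt_eqF //; lra.
rewrite ler_wpM2r //; first by rewrite divr_ge0 //; lra.
rewrite lerB //.
have -> : nn * ((NN - mm) / mm) / NN = nn * (NN - mm) * (mm * NN)^-1.
  by field; rewrite !gt_eqF //; lra.
rewrite ler_wpM2l //; first by rewrite mulr_ge0 //; lra.
rewrite lef_pV2 ?posrE; [nra|nra|].
by rewrite mulr_gt0 //; lra.
Qed.

(** 1 + th is (N - n) / (m - n), the inverse of the factor of index n, and
    the factors decrease with the index. *)
Lemma incl_factor_ge j : (j < n)%N -> 1 <= (1 + th) * A j.
Proof.
move=> jn.
have jR : j%:R + 1 <= n%:R :> R by rewrite natr1 ler_nat.
have j0 : 0 <= j%:R :> R by [].
have nmR : 2 * n%:R <= m%:R :> R by rewrite -natrM ler_nat.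
have mNR : m%:R <= N%:R :> R by rewrite ler_nat.
have n1 : 1 <= n%:R :> R by rewrite ler1n.
have -> : 1 + th = (N%:R - n%:R) / (m%:R - n%:R).
  by rewrite /th; field; rewrite gt_eqF //; lra.
rewrite /A mulf_div ler_pdivlMr ?mul1r; last by rewrite mulr_gt0; lra.
nra.
Qed.

Lemma incl_prob_ge0 : 0 <= incl_prob N m n :> R.
Proof.
rewrite prodr_ge0 // => j _; rewrite divr_ge0 // subr_ge0 ler_nat;
by have := ltn_ord j; lia.
Qed.

(** After the first n factors of the product on the left, each of the n - k
    others is compared by incl_factor_shift with the factor n places earlier;
    the k factors of the second incl_prob N m n that have no partner are at
    least 1 / (1 + th) by incl_factor_ge. *)
Lemma incl_prob_overlap k : (k <= n)%N ->
  incl_prob N m (2 * n - k) <= incl_prob N m n ^+ 2 *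
     expR (- (n%:R ^+ 2 * d / N%:R)) * ((1 + th) * expR (n%:R * d / N%:R)) ^+ k.
Proof.
move=> kn; have -> : (2 * n - k = n + (n - k))%N by lia.
have A0 j : (j < n)%N -> 0 <= A j.
  by move=> jn; rewrite divr_ge0 // subr_ge0 ler_nat; lia.
have th0 : 0 <= th by rewrite divr_ge0 // subr_ge0 ler_nat //; lia.
rewrite -[leRHS]mulrA; set cost := expR (- (n%:R ^+ 2 * d / N%:R)) * _.
rewrite incl_probD expr2 -[leRHS]mulrA ler_wpM2l ?incl_prob_ge0 //.
pose q := incl_prob N m (n - k) : R.
have q0 : 0 <= q by rewrite prodr_ge0 // => j _; apply: A0; have := ltn_ord j; lia.
set e := expR (- (n%:R * d / N%:R)).
apply: (@le_trans _ _ (e ^+ (n - k) * q)).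
  rewrite -[in e ^+ _](card_ord (n - k)) -prodr_const -big_split /=.
  apply: ler_prod => j _; apply/andP; split; last first.
    by apply: incl_factor_shift; have := ltn_ord j; lia.
  by rewrite divr_ge0 // subr_ge0 ler_nat; have := ltn_ord j; lia.
have qle : q <= incl_prob N m n * (1 + th) ^+ k.
  rewrite -[in incl_prob N m n](subnK kn) incl_probD -/q -mulrA.
  rewrite ler_peMr // -[in (1 + th) ^+ k](card_ord k) -prodr_const -big_split /=.
  apply: (big_ind (fun x : R => 1 <= x)) => // [x y x1 y1|j _].
    by rewrite (le_trans x1) // ler_peMr // (le_trans ler01).
  by rewrite mulrC; apply: incl_factor_ge; have := ltn_ord j; lia.
have -> : cost = e ^+ (n - k) * (1 + th) ^+ k.
  rewrite /cost exprMn mulrCA mulrC; congr (_ * _).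
  rewrite /e -!expRM_natl -expRD; congr expR; rewrite natrB //; ring.
by rewrite mulrCA ler_wpM2l // exprn_ge0 // expR_ge0.
Qed.

End inclusion_ratio.

Section overlap_coefficients.
Context {R : realType}.

(** The coefficient of C ^ s in overlap_bound C t t, relative to the number
    of all triple partitions. *)
Definition overlap_coeff (t s : nat) : R :=
  ('C(t, s) * triple_partition_number (t - s))%:R / (triple_partition_number t)%:R.

Lemma overlap_coeff0 t : overlap_coeff t 0 = 1.
Proof.
by rewrite /overlap_coeff bin0 mul1n subn0 divff // pnatr_eq0 -lt0n triple_partition_number_gt0.
Qed.

Lemma overlap_coeff_ge0 t s : 0 <= overlap_coeff t s.
Proof. by rewrite divr_ge0. Qed.

Lemma overlap_coeffS t s : overlap_coeff t.+1 s.+1 = overlap_coeff t s *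
  ((2 * (t%:R + 1)) / ((s%:R + 1) * ((3 * t%:R + 2) * (3 * t%:R + 1)))).
Proof.
rewrite /overlap_coeff subSS /= !natrM.
have b1 : (s%:R + 1) * ('C(t.+1, s.+1))%:R = (t%:R + 1) * ('C(t, s))%:R :> R.
  by rewrite !natr1 -!natrM -mul_bin_diag.
have b2 : 2 * ('C((3 * t).+2, 2))%:R = (3 * t%:R + 2) * (3 * t%:R + 1) :> R.
  have e : ('C((3 * t).+2, 2) * 2 = (3 * t).+2 * (3 * t).+1)%N.
    by have := bin_ffact (3 * t).+2 2; rewrite !ffactSS ffactn0 muln1.
  have : 2 * ('C((3 * t).+2, 2))%:R = ((3 * t).+2 * (3 * t).+1)%:R :> R.
    by rewrite -natrM -e mulnC.
  by move=> ->; rewrite [LHS]natrM -!natr1 [in LHS]natrM; ring.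
have -> : ('C(t.+1, s.+1))%:R = (t%:R + 1) * ('C(t, s))%:R / (s%:R + 1) :> R.
  by rewrite -b1 mulrC mulKf // natr1 pnatr_eq0.
have -> : ('C((3 * t).+2, 2))%:R = (3 * t%:R + 2) * (3 * t%:R + 1) / 2 :> R.
  by rewrite -b2 mulrC mulKf.
have t0 : 0 <= t%:R :> R by [].
have s0 : 0 <= s%:R :> R by [].
field; rewrite pnatr_eq0 -lt0n triple_partition_number_gt0 !gt_eqF //; lra.
Qed.

(** By overlap_coeffS the coefficient is 1 / s! times the product of 2 u /
    ((3 u - 1) (3 u - 2)) over the s largest values u <= t. *)
Lemma overlap_coeff_le_pow (g : R) t s : (s <= t)%N -> 0 <= g ->
  (forall u : nat, (t - s < u <= t)%N ->
     2 * u%:R <= g * ((3 * u%:R - 1) * (3 * u%:R - 2))) ->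
  overlap_coeff t s <= g ^+ s / (s`!)%:R.
Proof.
move=> st g0; elim: s t st => [|s IH] t st hu.
  by rewrite overlap_coeff0 expr0 divr1.
case: t st hu => // t st hu.
have t0 : 0 <= t%:R :> R by [].
have s0 : 0 <= s%:R :> R by [].
have ht : 2 * (t%:R + 1) <= g * ((3 * t%:R + 2) * (3 * t%:R + 1)).
  have := hu t.+1; rewrite -(natr1 t) => h; apply: le_trans (h _) _; first lia.
  by rewrite le_eqVlt; apply/orP; left; apply/eqP; ring.
have -> : g ^+ s.+1 / (s.+1)`!%:R = g ^+ s / (s`!)%:R * (g / (s%:R + 1)).
  by rewrite exprSr factS natrM -(natr1 s) invfM [_^-1 * _^-1]mulrC mulrACA.
rewrite overlap_coeffS ler_pM ?overlap_coeff_ge0 //.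
- by apply: IH => // u /andP[u1 u2]; apply: hu; lia.
- have X0 : 0 < (3 * t%:R + 2) * (3 * t%:R + 1) :> R by rewrite mulr_gt0; lra.
  rewrite ler_pdivrMr; last by rewrite mulr_gt0 //; lra.
  by rewrite [leRHS]mulrA divfK // gt_eqF //; lra.
Qed.

Lemma expn_succ_le_expR (t s : nat) : (s <= t)%N ->
  (t%:R + 1) ^+ s <= expR 1 * t%:R ^+ s :> R.
Proof.
case: t => [|t] st.
  by move: st; rewrite leqn0 => /eqP ->; rewrite !expr0 mulr1 -[leLHS]expR0 ler_expR.
have t0 : 0 < t.+1%:R :> R by [].
have -> : t.+1%:R + 1 = t.+1%:R * (1 + t.+1%:R^-1) :> R.
  by rewrite mulrDr mulr1 mulfV // gt_eqF.
rewrite exprMn mulrC ler_wpM2r ?exprn_ge0 //.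
apply: (@le_trans _ _ (expR t.+1%:R^-1 ^+ s)).
  by rewrite lerXn2r ?nnegrE ?expR_ge0 ?expR_ge1Dx // addr_ge0 // invr_ge0.
by rewrite -expRM_natl ler_expR ler_pdivrMr // mul1r ler_nat.
Qed.

(** Here each factor 2 u / ((3 u - 1) (3 u - 2)) is bounded by 1 / u, and t ^
    s / (t (t - 1) ... (t - s + 1)) is at most e ^ s. This bound is too weak
    for the main terms but holds for every s. *)
Lemma overlap_coeff_le_exp t s : (s <= t)%N ->
  overlap_coeff t s * t%:R ^+ s <= expR 1 ^+ s / (s`!)%:R.
Proof.
elim: s t => [|s IH] t st; first by rewrite overlap_coeff0 !expr0 divr1 mulr1.
case: t st => // t st.
have t0 : 0 <= t%:R :> R by [].
have s0 : 0 <= s%:R :> R by [].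
have -> : expR 1 ^+ s.+1 / (s.+1)`!%:R = (expR 1 ^+ s / (s`!)%:R) * (expR 1 / (s%:R + 1)) :> R.
  by rewrite exprSr factS natrM -(natr1 s) invfM [_^-1 * _^-1]mulrC mulrACA.
apply: (@le_trans _ _ ((overlap_coeff t s * t%:R ^+ s) * (expR 1 / (s%:R + 1)))); last first.
  by rewrite ler_wpM2r ?IH // divr_ge0 ?expR_ge0 //; lra.
rewrite overlap_coeffS -(natr1 t); set f := 2 * _ / _.
rewrite -[leRHS]mulrA -[leLHS]mulrA ler_wpM2l ?overlap_coeff_ge0 //.
have fle : f * (t%:R + 1) <= (s%:R + 1)^-1.
  rewrite /f -[leRHS]mul1r ler_pdivlMr; last lra.
  have -> : 2 * (t%:R + 1) / ((s%:R + 1) * ((3 * t%:R + 2) * (3 * t%:R + 1))) * (t%:R + 1) * (s%:R + 1)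
      = 2 * (t%:R + 1) ^+ 2 / ((3 * t%:R + 2) * (3 * t%:R + 1)) :> R.
    by field; rewrite !gt_eqF //; lra.
  rewrite ler_pdivrMr; last by rewrite mulr_gt0; lra.
  by nra.
have -> : t%:R ^+ s * (expR 1 / (s%:R + 1)) = (s%:R + 1)^-1 * (expR 1 * t%:R ^+ s) :> R.
  by ring.
rewrite exprS [leLHS]mulrA; apply: ler_pM => //; last exact: expn_succ_le_expR.
- by rewrite mulr_ge0 ?addr_ge0 // divr_ge0 // !mulr_ge0 //; lra.
Qed.

End overlap_coefficients.

Section exponential_series.
Context {R : realType}.
Implicit Types x K eps : R.

Lemma series_exp_coeffE x n :
  series (exp_coeff x) n = \sum_(s < n) x ^+ s / (s`!)%:R.
Proof. by rewrite /series /= big_mkord. Qed.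

Lemma nondecreasing_series_exp_coeff x : 0 <= x ->
  {homo series (exp_coeff x) : n m / (n <= m)%N >-> n <= m}.
Proof.
by move=> x0; apply: nondecreasing_series => n _ _; exact: exp_coeff_ge0.
Qed.

Lemma sum_exp_coeff_le x n : 0 <= x ->
  \sum_(s < n) x ^+ s / (s`!)%:R <= expR x.
Proof.
move=> x0; rewrite -series_exp_coeffE; apply: nondecreasing_cvgn_le.
  exact: nondecreasing_series_exp_coeff.
exact: is_cvg_series_exp_coeff.
Qed.

Lemma exp_coeff_tail K eps : 0 <= K -> 0 < eps -> exists M : nat, forall n,
  \sum_(s < n | (M <= s)%N) K ^+ s / (s`!)%:R <= eps.
Proof.
move=> K0 e0.
have : series (exp_coeff K) @ \oo --> expR K by exact: is_cvg_series_exp_coeff.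
move/cvgrPdist_le => /(_ _ e0)[M _ hM].
exists M => n; have [nM|Mn] := leqP n M.
  by rewrite big1 ?(ltW e0) // => s Ms; have := ltn_ord s; lia.
have := hM M (leqnn M); rewrite /= ger0_norm; last first.
  by rewrite subr_ge0 series_exp_coeffE sum_exp_coeff_le.
apply: le_trans; rewrite lerBrDr.
apply: le_trans (sum_exp_coeff_le n K0).
rewrite [leRHS](bigID (fun s : 'I_n => (M <= s)%N)) /= lerD2l series_exp_coeffE.
rewrite (big_ord_widen_cond n xpredT (fun s => K ^+ s / (s`!)%:R)) ?(ltnW Mn) //=.
by rewrite le_eqVlt; apply/orP; left; apply/eqP; apply: eq_bigl => s; rewrite ltnNge.
Qed.

End exponential_series.

Section overlap_bound_estimate.
Context {R : realType}.

Lemma overlap_boundE (C : R) t :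
  overlap_bound C t t = (triple_partition_number t)%:R *
    \sum_(s < t.+1) overlap_coeff t s * C ^+ s.
Proof.
rewrite /overlap_bound mulr_sumr; apply: eq_bigr => s _.
rewrite /overlap_coeff mulrA mulrCA divff ?mulr1 //.
by rewrite pnatr_eq0 -lt0n triple_partition_number_gt0.
Qed.

(** For s < M all the u in overlap_coeff_le_pow exceed t - M, which makes the
    factor g uniform and the terms sum to part of an exponential series; the
    terms with s >= M are bounded by overlap_coeff_le_exp. *)
Lemma sum_overlap_coeff_le (C K : R) (t M : nat) : (M < t)%N -> 0 <= C ->
  C * expR 1 <= K * t%:R ->
  \sum_(s < t.+1) overlap_coeff t s * C ^+ s <=
    expR (C * (2 * t%:R / (9 * (t%:R - M%:R) ^+ 2))) +
    \sum_(s < t.+1 | (M <= s)%N) K ^+ s / (s`!)%:R.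
Proof.
move=> Mt C0 CK; set g := 2 * t%:R / _.
have tM : 0 < t%:R - M%:R :> R by rewrite subr_gt0 ltr_nat.
have t0 : 0 < t%:R :> R by rewrite ltr0n; lia.
have g0 : 0 <= g by rewrite divr_ge0 // ?mulr_ge0 ?sqr_ge0 // ltW.
rewrite (bigID (fun s : 'I_t.+1 => (M <= s)%N)) /= addrC lerD //; last first.
  apply: ler_sum => s Ms.
  have st : (s <= t)%N by have := ltn_ord s; lia.
  have := @overlap_coeff_le_exp R t s st.
  rewrite -ler_pdivlMr ?exprn_gt0 // => h.
  apply: (@le_trans _ _ (expR 1 ^+ s / (s`!)%:R / t%:R ^+ s * C ^+ s)).
    by rewrite ler_wpM2r ?exprn_ge0.
  have -> : expR 1 ^+ s / (s`!)%:R / t%:R ^+ s * C ^+ s = (C * expR 1 / t%:R) ^+ s / (s`!)%:R.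
    by rewrite !exprMn exprVn; ring.
  rewrite ler_wpM2r ?invr_ge0 // lerXn2r ?nnegrE //.
  - by rewrite !mulr_ge0 ?expR_ge0 ?invr_ge0 // ltW.
  - apply: le_trans (_ : C * expR 1 / t%:R <= _); last by rewrite ler_pdivrMr.
    by rewrite !mulr_ge0 ?expR_ge0 ?invr_ge0 // ltW.
  - by rewrite ler_pdivrMr.
have Cg0 : 0 <= C * g by rewrite mulr_ge0.
apply: le_trans (sum_exp_coeff_le M Cg0).
rewrite (big_ord_widen_cond t.+1 xpredT (fun s => (C * g) ^+ s / (s`!)%:R)); last lia.
rewrite (eq_bigl (fun s : 'I_t.+1 => (s < M)%N)); last by move=> s; rewrite -ltnNge.
apply: ler_sum => s /= sM.
rewrite exprMn [C ^+ s * _]mulrC [leRHS]mulrAC ler_wpM2r ?exprn_ge0 //.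
apply: overlap_coeff_le_pow => //; first lia.
move=> u /andP[u1 u2].
have uM : t%:R - M%:R <= u%:R - 1 :> R.
  rewrite lerBlDr addrAC lerBrDr -natrD natr1 ler_nat; lia.
have ut : u%:R <= t%:R :> R by rewrite ler_nat.
apply: (@le_trans _ _ (g * (9 * (t%:R - M%:R) ^+ 2))).
  rewrite /g divfK; first lra.
  by rewrite mulf_neq0 ?expf_neq0 // gt_eqF.
rewrite ler_wpM2l //; nra.
Qed.

End overlap_bound_estimate.

Section second_moment.
Context {R : realType} (t : nat).
Local Notation n := (3 * t)%N.
Local Notation N := 'C(n, 2).
Local Notation D := (triple_partitions [set: 'I_n]%SET).

Lemma second_moment_gnm_le (m : nat) (d z : R) :
  (0 < t)%N -> (2 * n <= m)%N -> (m <= N)%N ->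
  d = (N%:R - m%:R) / m%:R ->
  z = (1 + (N%:R - m%:R) / (m%:R - n%:R)) * expR (n%:R * d / N%:R) ->
  Ex (@gnm R n m) (fun G => X_ G ^+ 2) <=
  Ex (@gnm R n m) (@X_ R n) ^+ 2 * (expR (- (n%:R ^+ 2 * d / N%:R)) *
    \sum_(s < t.+1) overlap_coeff t s * overlap_cost z n ^+ s).
Proof.
move=> t0 nm mN dE zE; have n0 : (0 < n)%N by lia.
have d0 : 0 <= d by rewrite dE divr_ge0 // subr_ge0 ler_nat.
have z1 : 1 <= z.
  rewrite zE -[leLHS]mulr1 ler_pM //.
    by rewrite lerDl divr_ge0 // subr_ge0 ler_nat //; lia.
  by rewrite -expR0 ler_expR divr_ge0 // mulr_ge0.
rewrite second_moment_gnm_X // mean_gnm_X //.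
set e := expR _; set S := \sum_(s < _) _.
apply: (@le_trans _ _ (\sum_(P in D) \sum_(P' in D)
  incl_prob N m n ^+ 2 * e * z ^+ #|(partition_graph P :&: partition_graph P')%SET|)).
  apply: ler_sum => P PD; apply: ler_sum => P' P'D.
  rewrite zE /e dE; apply: incl_prob_overlap => //.
  rewrite -[leqRHS](card_partition_graph_setT PD).
  by rewrite subset_leq_card // finset.subsetIl.
apply: (@le_trans _ _ (\sum_(P in D) incl_prob N m n ^+ 2 * e * (#|D|%:R * S))).
  apply: ler_sum => P PD; rewrite -mulr_sumr ler_wpM2l //.
    by rewrite mulr_ge0 ?expR_ge0 // sqr_ge0.
  by rewrite card_triple_partitions_setT -overlap_boundE; exact: sum_common_edges_le.
by rewrite sumr_const -[leLHS]mulr_natl le_eqVlt; apply/orP; left; apply/eqP; ring.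
Qed.

End second_moment.

Lemma natr_bin2 {R : realFieldType} (n : nat) : (0 < n)%N ->
  'C(n, 2)%:R = n%:R * (n%:R - 1) / 2 :> R.
Proof.
move=> n0; have : ('C(n, 2) * 2 = n * n.-1)%N.
  by rewrite -[2%N in LHS]/(2`!) bin_ffact ffactnS ffactn1.
move=> /(congr1 (fun x : nat => x%:R : R)); rewrite !natrM -subn1 natrB //.
by move=> <-; rewrite mulfK.
Qed.

Lemma inv_sqr_1B_le {R : realFieldType} (x k : R) : 0 <= x -> x <= k / 4 -> k <= 1 ->
  1 <= (1 + k) * (1 - x) ^+ 2.
Proof. by move=> x0 xk k1; nra. Qed.

(** Put w = N / m = 1 + d and r = n / m <= k / 4. Then 1 + th <= w / (1 - r)
    and the exponential in z is at most exp(r) <= 1 / (1 - r), so that z <= w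
    / (1 - r) ^ 2 <= w (1 + k). In the same way t ^ 2 / (t - M) ^ 2 <= 1 + k.
    The main term 2 t ^ 2 / (t - M) ^ 2 (z - 1) is therefore 2 (w - 1) = 2 d
    up to a multiple of k, and the part that comes from z ^ 3 - 1 carries a
    factor 1 / t. *)
Lemma overlap_exponent_le {R : realType} (a k d z : R) (t M m n N : nat) :
  n = (3 * t)%N -> N = 'C(n, 2) ->
  0 < a -> a <= 1 -> 0 < k -> k <= 1 ->
  (0 < t)%N -> (m <= N)%N -> a * N%:R <= m%:R ->
  2 / (a * (n%:R - 1)) <= k / 4 -> M%:R / t%:R <= k / 4 -> 2 / t%:R <= k ->
  d = (N%:R - m%:R) / m%:R ->
  z = (1 + (N%:R - m%:R) / (m%:R - n%:R)) * expR (n%:R * d / N%:R) ->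
  [/\ (4 * n <= m)%N, 1 <= z, z <= 2 / a, 0 <= d &
  overlap_cost z n * (2 * t%:R / (9 * (t%:R - M%:R) ^+ 2)) <= 2 * d + 8 * k / a ^+ 3].
Proof.
move=> nt NE0 a0 a1 k0 k1 t0 mN am nuk Mk tk dE zE.
have tR : 1 <= t%:R :> R by rewrite ler1n.
have nE : n%:R = 3 * t%:R :> R by rewrite nt natrM.
have NE : N%:R = n%:R * (n%:R - 1) / 2 :> R.
  by rewrite NE0 natr_bin2 // nt muln_gt0.
have mNR : m%:R <= N%:R :> R by rewrite ler_nat.
have NR : 0 < N%:R :> R by rewrite NE divr_gt0 // mulr_gt0 //; lra.
have aN : 0 < a * N%:R by rewrite mulr_gt0.
have mR : 0 < m%:R :> R by lra.
set r : R := n%:R / m%:R.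
have rk : r <= k / 4.
  apply: le_trans nuk; rewrite /r ler_pdivrMr // mulrAC ler_pdivlMr; last by rewrite mulr_gt0 //; lra.
  have -> : n%:R * (a * (n%:R - 1)) = 2 * (a * N%:R) by rewrite NE; field.
  lra.
have r0 : 0 <= r by rewrite divr_ge0.
have r1 : r <= 1 / 4 by lra.
have n4 : 4 * n%:R <= m%:R :> R by move: r1; rewrite /r ler_pdivrMr // => ?; lra.
set w : R := N%:R / m%:R.
have dw : d = w - 1 by rewrite dE mulrBl divff // gt_eqF.
have w1 : 1 <= w by rewrite /w ler_pdivlMr // mul1r.
have wa : w <= 1 / a by rewrite /w ler_pdivrMr // mulrAC ler_pdivlMr // mul1r mulrC.
have th : (1 : R) <= 1 + (N%:R - m%:R) / (m%:R - n%:R) <= w / (1 - r).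
  apply/andP; split; first by rewrite lerDl divr_ge0 //; lra.
  have -> : w / (1 - r) = N%:R / (m%:R - n%:R).
    have -> : 1 - r = (m%:R - n%:R) / m%:R by rewrite /r mulrBl divff // gt_eqF.
    by rewrite /w invf_div mulrA divfK // gt_eqF.
  have -> : 1 + (N%:R - m%:R) / (m%:R - n%:R) = (N%:R - n%:R) / (m%:R - n%:R) :> R.
    by field; rewrite gt_eqF //; lra.
  have := ler0n R n => nn0; have mn0 : 0 <= m%:R - n%:R :> R by clear -n4 mR nn0; lra.
  by rewrite ler_wpM2r ?invr_ge0 //; clear -nn0; lra.
have expd : 1 <= expR (n%:R * d / N%:R) <= (1 - r)^-1.
  apply/andP; split.
    by rewrite -expR0 ler_expR divr_ge0 // mulr_ge0 // dw; lra.
  apply: (@le_trans _ _ (expR r)).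
    have -> : n%:R * d / N%:R = r * ((N%:R - m%:R) / N%:R) by rewrite dE /r; ring.
    by rewrite ler_expR ler_piMr // ler_pdivrMr //; lra.
  rewrite -[expR r]invrK -expRN lef_pV2 ?posrE ?expR_gt0 //; last lra.
  exact: expR_ge1Dx.
have z1 : 1 <= z.
  move: th expd => /andP[h1 _] /andP[h2 _].
  by rewrite zE -[leLHS]mulr1 ler_pM.
have zw : z <= w * (1 + k).
  apply: (@le_trans _ _ (w / (1 - r) * (1 - r)^-1)).
    move: th expd => /andP[h1 ?] /andP[h2 ?].
    by rewrite zE ler_pM // (le_trans ler01).
  rewrite -mulrA -invfM -expr2 ler_wpM2l //; first lra.
  rewrite -[leLHS]mul1r ler_pdivrMr; last by rewrite exprn_gt0 //; lra.
  exact: inv_sqr_1B_le.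
have ia : 1 <= 1 / a by rewrite ler_pdivlMr // mul1r.
have za : z <= 2 / a.
  apply: (le_trans zw); have -> : 2 / a = 1 / a * 2 by ring.
  by clear -w1 wa k0 k1; apply: ler_pM => //; lra.
split => //; first by rewrite -(ler_nat R) natrM.
  by lra.
have M0 : 0 <= M%:R :> R by [].
have t00 : 0 < t%:R :> R by lra.
have tM : 0 < t%:R - M%:R :> R.
  have : M%:R / t%:R <= 1 / 4 :> R by clear -Mk k1; lra.
  by clear -t00; rewrite ler_pdivrMr //; lra.
pose Q : R := t%:R ^+ 2 / (t%:R - M%:R) ^+ 2.
have Q0 : 0 <= Q by rewrite divr_ge0 // sqr_ge0.
have Qk : Q <= 1 + k.
  rewrite /Q ler_pdivrMr ?exprn_gt0 //.
  have h : 1 <= (1 + k) * (1 - M%:R / t%:R) ^+ 2.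
    by apply: inv_sqr_1B_le => //; rewrite divr_ge0.
  have -> : t%:R - M%:R = t%:R * (1 - M%:R / t%:R) :> R.
    by rewrite mulrBr mulr1 mulrC divfK // gt_eqF //; lra.
  by rewrite exprMn mulrCA -[leLHS]mulr1 ler_wpM2l // sqr_ge0.
have Qt : Q / t%:R <= k.
  by apply: le_trans tk; rewrite ler_wpM2r ?invr_ge0 //; clear -Qk k1; lra.
have -> : overlap_cost z n * (2 * t%:R / (9 * (t%:R - M%:R) ^+ 2)) =
    2 * (Q * (z - 1)) + 2 / 9 * (Q / t%:R * (z ^+ 3 - 1)).
  rewrite /overlap_cost nE /Q; field.
  by rewrite !gt_eqF //; lra.
have h1 : Q * (z - 1) <= (1 + k) * (w * (1 + k) - 1).
  by clear -Q0 Qk z1 zw; apply: ler_pM => //; lra.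
have z3 : 1 <= z ^+ 3 by rewrite exprn_ege1.
have za3 : z ^+ 3 <= 8 / a ^+ 3.
  have -> : 8 / a ^+ 3 = (2 / a) ^+ 3 by rewrite exprMn exprVn; ring.
  by clear -z1 za; rewrite lerXn2r ?nnegrE //; lra.
have h2 : Q / t%:R * (z ^+ 3 - 1) <= k * (8 / a ^+ 3).
  have Qt0 : 0 <= Q / t%:R by rewrite divr_ge0 ?ler0n.
  by clear -Qt0 Qt z3 za3; apply: ler_pM => //; lra.
have ia3 : 1 / a <= 1 / a ^+ 3.
  rewrite !div1r lef_pV2 ?posrE ?exprn_gt0 //.
  by rewrite exprS ler_piMr ?exprn_ile1 // ltW.
have h3 : k * w <= k * (1 / a ^+ 3) by rewrite ler_wpM2l ?(ltW k0) // (le_trans wa).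
have kw0 : 0 <= k * w by rewrite mulr_ge0 ?(ltW k0) // (le_trans ler01).
have h4 : k * (k * w) <= k * w by rewrite ler_piMl.
rewrite dw.
set b := 1 / a ^+ 3 in ia3 h3 *.
have e8 : 8 / a ^+ 3 = 8 * b by rewrite /b mulrA mulr1.
rewrite e8 in h2.
have -> : 8 * k / a ^+ 3 = 8 * (k * b) by rewrite /b; ring.
have : k * (8 * b) = 8 * (k * b) by ring.
have : (1 + k) * (w * (1 + k) - 1) = w - 1 + 2 * (k * w) + k * (k * w) - k by ring.
clear -h1 h2 h3 h4 kw0 k0; lra.
Qed.

(** The factor exp(- n ^ 2 d / N) <= exp(- 2 d) of second_moment_gnm_le
    cancels the exponential exp(2 d + 8 k / a ^ 3) that bounds the main terms
    of the overlap sum, whatever m >= a N is. *)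
Lemma second_moment_uniform {R : realType} (a eta : R) :
  0 < a -> a <= 1 -> 0 < eta -> exists t1 : nat, forall t, (t1 <= t)%N ->
  forall m, (m <= 'C(3 * t, 2))%N -> a * 'C(3 * t, 2)%:R <= m%:R ->
  0 < Ex (@gnm R (3 * t) m) (@X_ R (3 * t)) /\
  Ex (@gnm R (3 * t) m) (fun G => X_ G ^+ 2) <=
    (1 + eta) * Ex (@gnm R (3 * t) m) (@X_ R (3 * t)) ^+ 2.
Proof.
move=> a0 a1 e0.
have a30 : 0 < a ^+ 3 by rewrite exprn_gt0.
have [k [k0 k1 kexp]] : exists k : R,
    [/\ 0 < k, k <= 1 & expR (8 * k / a ^+ 3) <= 1 + eta / 2].
  have l0 : 0 < a ^+ 3 / 8 * ln (1 + eta / 2).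
    by rewrite mulr_gt0 ?divr_gt0 // ln_gt0 //; lra.
  exists (Num.min 1 (a ^+ 3 / 8 * ln (1 + eta / 2))); split.
  - by rewrite lt_min ltr01.
  - by rewrite ge_min lexx.
  - have {2}-> : 1 + eta / 2 = expR (ln (1 + eta / 2)) by rewrite lnK // posrE; lra.
    rewrite ler_expR ler_pdivrMr // mulrC -ler_pdivlMr // ge_min.
    by apply/orP; right; rewrite le_eqVlt; apply/orP; left; apply/eqP; ring.
(* K t dominates overlap_cost z n * expR 1, because z <= 2 / a. *)
pose K := 26 * expR 1 / a ^+ 3.
have K0 : 0 <= K by rewrite divr_ge0 ?mulr_ge0 ?expR_ge0 // ltW.
have [M tail] := exp_coeff_tail K0 (divr_gt0 e0 (ltr0Sn R 1)).
(* The terms of b enforce 2 / (a (n - 1)) <= k / 4, M / t <= k / 4, 2 / t <= k and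
   M < t, in this order. *)
pose b := 8 / (a * k) + 4 * M%:R / k + 2 / k + M%:R + 1.
have b1 : 0 <= 8 / (a * k) by rewrite divr_ge0 // mulr_ge0 // ltW.
have b2 : 0 <= 4 * M%:R / k by rewrite divr_ge0 ?mulr_ge0 // ltW.
have b3 : 0 <= 2 / k by rewrite divr_ge0 // ltW.
have M0 : 0 <= M%:R :> R by [].
have b0 : 0 <= b by rewrite /b; lra.
exists (Num.bound b) => t tb m mN am.
have bt : b < t%:R.
  by apply: lt_le_trans (archi_boundP b0) _; rewrite ler_nat.
have [t1 MtR bt1 bt2 bt3] : [/\ (1 : R) < t%:R, (M%:R : R) < t%:R, 8 / (a * k) < t%:R,
    4 * M%:R / k < t%:R & 2 / k < t%:R :> R].
  by move: bt; rewrite /b => bt; split; lra.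
clear bt b0 b1 b2 b3; clearbody b.
have t0 : (0 < t)%N by rewrite -(ltr_nat R); lra.
have nE : (3 * t)%:R = 3 * t%:R :> R by rewrite natrM.
have NE : 'C(3 * t, 2)%:R = (3 * t)%:R * ((3 * t)%:R - 1) / 2 :> R.
  by apply: natr_bin2; rewrite muln_gt0.
have Mt : (M < t)%N by move: MtR; rewrite ltr_nat; exact: id.
have h1 : 2 / (a * ((3 * t)%:R - 1)) <= k / 4.
  rewrite ler_pdivrMr; last by rewrite mulr_gt0 //; lra.
  move: bt1.
  rewrite ltr_pdivrMr ?mulr_gt0 // => h.
  rewrite nE; apply: (@le_trans _ _ (k / 4 * (a * t%:R))); first by move: h; lra.
  by rewrite ler_wpM2l ?divr_ge0 ?(ltW k0) // ler_wpM2l ?(ltW a0) //; lra.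
have h2 : M%:R / t%:R <= k / 4.
  rewrite ler_pdivrMr; last lra.
  move: bt2.
  by rewrite ltr_pdivrMr //; lra.
have h3 : 2 / t%:R <= k.
  rewrite ler_pdivrMr; last lra.
  move: bt3.
  by rewrite ltr_pdivrMr //; lra.
pose N := 'C(3 * t, 2); pose n := (3 * t)%N.
pose d : R := (N%:R - m%:R) / m%:R.
pose z : R := (1 + (N%:R - m%:R) / (m%:R - n%:R)) * expR (n%:R * d / N%:R).
have [m4 z1 za d0 hexp] := @overlap_exponent_le R a k d z t M m n N erefl erefl
  a0 a1 k0 k1 t0 mN am h1 h2 h3 erefl erefl.
have mean0 : 0 < Ex (@gnm R (3 * t) m) (@X_ R (3 * t)).
  rewrite mean_gnm_X // card_triple_partitions_setT mulr_gt0 ?ltr0n ?triple_partition_number_gt0 //.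
  rewrite prodr_gt0 // => j _; have jn := ltn_ord j.
  have jm : (j < m)%N := leq_trans jn (leq_trans (leq_pmull n (isT : 0 < 4)%N) m4).
  by rewrite divr_gt0 // subr_gt0 ltr_nat ?(leq_trans jm).
split => //.
have nm : (2 * (3 * t) <= m)%N.
  by apply: leq_trans m4; rewrite leq_mul2r orbT.
apply: le_trans (@second_moment_gnm_le R t m d z t0 nm mN erefl erefl) _.
rewrite [leRHS]mulrC ler_wpM2l ?sqr_ge0 //.
have CK : overlap_cost z n * expR 1 <= K * t%:R.
  have -> : K * t%:R = 26 / a ^+ 3 * t%:R * expR 1 by rewrite /K; ring.
  rewrite ler_wpM2r ?expR_ge0 // /overlap_cost.
  have za3 : z ^+ 3 <= 8 * (1 / a ^+ 3).
    have -> : 8 * (1 / a ^+ 3) = (2 / a) ^+ 3 by rewrite exprMn exprVn; ring.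
    by clear -z1 za; rewrite lerXn2r ?nnegrE //; lra.
  have ia3 : 1 / a <= 1 / a ^+ 3.
    rewrite !div1r lef_pV2 ?posrE ?exprn_gt0 //.
    by rewrite exprS ler_piMr ?exprn_ile1 // ltW.
  have ia0 : 0 <= 1 / a by rewrite divr_ge0 // ltW.
  rewrite /n nE.
  have h : t%:R * (z - 1) <= t%:R * (2 * (1 / a ^+ 3)) by rewrite ler_wpM2l //; lra.
  have -> : 26 / a ^+ 3 * t%:R = 18 * (t%:R * (1 / a ^+ 3)) + 8 * (t%:R * (1 / a ^+ 3)) by ring.
  have h' : 1 / a ^+ 3 <= t%:R * (1 / a ^+ 3).
    by rewrite ler_peMl ?(ltW t1) // divr_ge0 // ltW.
  by clear -h h' za3; lra.
have := @sum_overlap_coeff_le R _ K t M Mt (overlap_cost_ge0 z1 n) CK.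
move=> hs; have {hs} hs := le_trans hs (lerD (lexx _) (tail _)).
apply: (@le_trans _ _ (expR (- (2 * d)) * (expR (2 * d + 8 * k / a ^+ 3) + eta / 2))).
  rewrite ler_pM ?expR_ge0 //.
  - by rewrite sumr_ge0 // => s _; rewrite mulr_ge0 ?overlap_coeff_ge0 ?exprn_ge0 ?overlap_cost_ge0.
  - have N0 : 0 < 'C(3 * t, 2)%:R :> R by rewrite NE nE; clear -t1; rewrite divr_gt0 // mulr_gt0 //; lra.
    rewrite ler_expR lerN2 ler_pdivlMr //.
    rewrite [leRHS]mulrC [2 * d]mulrC -mulrA ler_wpM2l // NE nE.
    clear -t1; nra.
  - by apply: le_trans hs _; rewrite lerD2r ler_expR.
rewrite mulrDr -expRD addrA addNr add0r.
have ed : expR (- (2 * d)) <= 1 by rewrite -[leRHS]expR0 ler_expR; clear -d0; lra.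
have : expR (- (2 * d)) * (eta / 2) <= eta / 2 by rewrite ler_piMl // divr_ge0 // ltW.
by clear -kexp; lra.
Qed.

(** * The normal distribution function *)

Section normal_cdf.
Context {R : realType}.
Implicit Types x y c : R.
Local Notation gamma := (@normal_prob R 0 1).

Definition normal_cdf x : R := fine (gamma [set` `]-oo, x]]).

Lemma normal_probE x : gamma [set` `]-oo, x]] = (normal_cdf x)%:E.
Proof. by rewrite /normal_cdf fineK // fin_num_measure. Qed.

Lemma normal_cdf_itv x y : x <= y ->
  gamma [set` `]x, y]] = (normal_cdf y - normal_cdf x)%:E.
Proof.
move=> xy; rewrite EFinB -!normal_probE.
have : `]x, y]%classic = `]-oo, y] `\` `]-oo, x] => [|->].
  by rewrite -[RHS]setCK setCD setCitvl setUC -[LHS]setCK setCitv.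
rewrite measureD ?setIidr//; first exact: subset_itvl.
by rewrite -ge0_fin_numE// fin_num_measure.
Qed.

Lemma normal_cdf_nd x y : x <= y -> normal_cdf x <= normal_cdf y.
Proof.
by move=> xy; rewrite -subr_ge0 -lee_fin -normal_cdf_itv //.
Qed.

Lemma normal_cdf_ge0 x : 0 <= normal_cdf x.
Proof. by rewrite -lee_fin -normal_probE. Qed.

Lemma normal_cdf_le1 x : normal_cdf x <= 1.
Proof. by rewrite -lee_fin -normal_probE probability_le1. Qed.

Lemma normal_cdf_sub_bounds x y (l u : R) : x <= y -> 0 <= l ->
  (forall z, x <= z <= y -> l <= normal_pdf 0 1 z <= u) ->
  l * (y - x) <= normal_cdf y - normal_cdf x <= u * (y - x).
Proof.
move=> xy l0 h.
have hz z : z \in `]x, y] -> l <= normal_pdf 0 1 z <= u.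
  by rewrite in_itv /= => /andP[xz zy]; apply: h; rewrite (ltW xz).
have cstE c : (\int[lebesgue_measure]_(_ in `]x, y]) c%:E = (c * (y - x))%:E)%E.
  rewrite integral_cst //= lebesgue_measure_itv /= lte_fin.
  move: xy; rewrite le_eqVlt => /orP[/eqP ->|xy]; last by rewrite xy EFinM EFinB.
  by rewrite ltxx subrr mulr0 mule0.
rewrite -!lee_fin -normal_cdf_itv // -!cstE; apply/andP; split.
  apply: ge0_le_integral => //=.
  - by apply/measurable_EFinP; apply: measurable_funTS; exact: measurable_normal_pdf.
  - by move=> z zI; rewrite lee_fin; have /andP[] := hz z zI.
have u0 : 0 <= u.
  have /h/andP[h1 h2] : x <= x <= y by rewrite lexx xy.
  exact: le_trans l0 (le_trans h1 h2).
apply: ge0_le_integral => //=.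
- by move=> z _; rewrite lee_fin normal_pdf_ge0.
- by apply/measurable_EFinP; apply: measurable_funTS; exact: measurable_normal_pdf.
- by move=> z zI; rewrite lee_fin; have /andP[] := hz z zI.
Qed.

Lemma normal_pdf01E x : normal_pdf 0 1 x = normal_peak 1 * expR (- x ^+ 2 / 2).
Proof. by rewrite normal_pdfE ?oner_eq0 // /normal_fun subr0 expr1n. Qed.

Let idTR : measurableTypeR R -> R := idfun.

#[local] HB.instance Definition _ :=
  @isMeasurableFun.Build _ _ _ _ idTR (@measurable_id _ _ setT).

Lemma normal_cdf_tails (eps : R) : 0 < eps -> exists A0 : R, forall A, A0 <= A ->
  normal_cdf (- A) <= eps /\ 1 - eps <= normal_cdf A.
Proof.
move=> e0.
have hNy : normal_cdf @ -oo --> (0 : R).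
  exact/fine_cvg/(@cvg_cdfNy0 _ _ _ gamma (idTR : {RV gamma >-> R})).
have hy : normal_cdf @ +oo --> (1 : R).
  exact/fine_cvg/(@cvg_cdfy1 _ _ _ gamma (idTR : {RV gamma >-> R})).
move/cvgrPdist_le : hNy => /(_ _ e0)[A1 [_ h1]].
move/cvgrPdist_le : hy => /(_ _ e0)[A2 [_ h2]].
exists (Num.max (- A1) A2 + 1) => A hA.
have A1A : - A < A1.
  by rewrite ltrNl; apply: lt_le_trans hA; rewrite ltr_pwDr // le_max lexx.
have A2A : A2 < A.
  by apply: lt_le_trans hA; rewrite ltr_pwDr // le_max lexx orbT.
split.
  have := h1 _ A1A; rewrite /= sub0r normrN ger0_norm //.
  exact: normal_cdf_ge0.
have := h2 _ A2A; rewrite /= ger0_norm ?subr_ge0 ?normal_cdf_le1 //.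
by move=> h; rewrite lerBlDr addrC -lerBlDr.
Qed.

End normal_cdf.

(** * The theorem of de Moivre and Laplace, uniformly in p *)

(** 1 / (1 + v) = 1 - v / (1 + v) <= exp(- v / (1 + v)), and v / (1 + v) >= v
    - 2 v ^ 2. *)
Lemma expR_le_1Dx {R : realType} (v : R) : `|v| <= 1 / 2 ->
  expR (v - 2 * v ^+ 2) <= 1 + v.
Proof.
rewrite ler_norml => /andP[v1 v2].
have v0 : 0 < 1 + v by lra.
rewrite -[leRHS]invrK -[leLHS]invrK -expRN lef_pV2 ?posrE ?invr_gt0 ?expR_gt0 //.
apply: (@le_trans _ _ (expR (- v / (1 + v)))).
  have {1}-> : (1 + v)^-1 = 1 + - v / (1 + v) by field; rewrite gt_eqF.
  exact: expR_ge1Dx.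
rewrite ler_expR ler_pdivrMr //.
nra.
Qed.

Lemma geometric_chain {R : realFieldType} (r : nat -> R) (e : R) (i j : nat) :
  1 <= e -> (forall k, 0 <= r k) ->
  (forall k, (i <= k)%N -> (k.+1 < j)%N -> r k <= e * r k.+1 /\ r k.+1 <= e * r k) ->
  forall k l, (i <= k < j)%N -> (i <= l < j)%N -> r k <= e ^+ (j - i) * r l.
Proof.
move=> e1 r0 hr.
have e0 : 0 <= e by lra.
have aux d k : (i <= k)%N -> (k + d < j)%N ->
    r k <= e ^+ d * r (k + d)%N /\ r (k + d)%N <= e ^+ d * r k.
  elim: d => [|d IH] ik kd; first by rewrite addn0 expr0 !mul1r.
  rewrite addnS in kd *.
  have [h1 h2] := IH ik (ltnW kd).
  have [h3 h4] := hr (k + d)%N (leq_trans ik (leq_addr _ _)) kd.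
  split; first by rewrite exprSr -mulrA (le_trans h1) // ler_wpM2l ?exprn_ge0.
  by rewrite exprS -mulrA (le_trans h4) // ler_wpM2l.
have mono d k l : (d <= j - i)%N -> r k <= e ^+ d * r l -> r k <= e ^+ (j - i) * r l.
  by move=> dj h; apply: (le_trans h); rewrite ler_wpM2r // ler_weXn2l.
move=> k l /andP[ik kj] /andP[il lj].
have [kl|/ltnW lk] := leqP k l.
  have := aux (l - k)%N k ik; rewrite subnKC // => /(_ lj)[h _].
  by apply: mono h; rewrite leq_sub // ltnW.
have := aux (k - l)%N l il; rewrite subnKC // => /(_ kj)[_ h].
by apply: mono h; rewrite leq_sub // ltnW.
Qed.

Section binomial_step.
Context {R : realType} (a A p : R) (N : nat).
Hypotheses (a0 : 0 < a) (A0 : 0 <= A) (pa : a <= p <= 1 - a) (N0 : (0 < N)%N).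
Local Notation s := (Num.sqrt N%:R : R).
Hypothesis largeN : (A * s + 1) / (a * N%:R) <= 1 / 2.

Definition step_error : R := 5 * (A ^+ 2 + 1) / (a ^+ 2 * N%:R).

(** If k successes deviate from the mean by y = k - N p, then r is the ratio
    of the probabilities of k + 1 and k successes, and expR q the ratio of
    the normal densities. One has r = (1 + u) / (1 + v) with u = - y / (N (1
    - p)) and v = (y + 1) / (N p); as u and v are O(1 / sqrt N), the
    logarithm of r is u - v up to O(1 / N). *)
Lemma binomial_ratio (y r q : R) : `|y| <= A * s -> `|y + 1| <= A * s + 1 ->
  r = (N%:R * (1 - p) - y) * p / ((N%:R * p + y + 1) * (1 - p)) ->
  q = - (2 * y + 1) / (2 * (N%:R * p * (1 - p))) ->
  expR (q - step_error) <= r <= expR (q + step_error).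
Proof.
move=> yA y1A rdef qdef; have [a0' A0'] := (a0, A0); have /andP[ap pa1] := pa.
have a_1 : a <= 1 by lra.
have NR : 1 <= N%:R :> R by rewrite ler1n.
have s2 : s ^+ 2 = N%:R by rewrite sqr_sqrtr.
have s1 : 1 <= s by rewrite -[leLHS]sqrtr1 ler_wsqrtr.
have p0 : 0 < p by lra.
have q0 : 0 < 1 - p by lra.
have As0 : 0 <= A * s by rewrite mulr_ge0 //; lra.
have aN0 : 0 < a * N%:R by rewrite mulr_gt0 //; lra.
have Np0 : 0 < N%:R * p by rewrite mulr_gt0 //; lra.
have Nq0 : 0 < N%:R * (1 - p) by rewrite mulr_gt0 //; lra.
pose D := (A ^+ 2 + 1) / (a ^+ 2 * N%:R).
have D0 : 0 <= D by rewrite divr_ge0 ?addr_ge0 ?sqr_ge0 // mulr_ge0 ?sqr_ge0 //; lra.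
have stepD : step_error = 5 * D by rewrite /step_error /D mulrA.
have bnd (w c : R) : `|w| <= A * s + 1 -> a <= c ->
    `|w / (N%:R * c)| <= 1 / 2 /\ 2 * (w / (N%:R * c)) ^+ 2 <= 4 * D.
  move=> wA ac.
  have c0 : 0 < N%:R * c by rewrite mulr_gt0 //; lra.
  have le1 : `|w / (N%:R * c)| <= (A * s + 1) / (a * N%:R).
    rewrite normrM [X in _ * X]gtr0_norm ?invr_gt0 //.
    rewrite ler_pM ?invr_ge0 ?(ltW c0) // lef_pV2 ?posrE // mulrC ler_wpM2l //; lra.
  split; first exact: le_trans le1 largeN.
  rewrite -real_normK ?num_real //.
  apply: (@le_trans _ _ (2 * ((A * s + 1) / (a * N%:R)) ^+ 2)).
    rewrite ler_wpM2l // lerXn2r ?nnegrE ?normr_ge0 //.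
    by rewrite divr_ge0 //; lra.
  have -> : 4 * D = 2 * ((2 * (A ^+ 2 + 1) * N%:R) / (a * N%:R) ^+ 2).
    by rewrite /D; field; rewrite !gt_eqF //; lra.
  rewrite ler_wpM2l // exprMn exprVn ler_wpM2r ?invr_ge0 ?sqr_ge0 //.
  rewrite -[X in _ <= _ * X]s2; have : 0 <= (A * s - 1) ^+ 2 by rewrite sqr_ge0.
  have : 1 <= s ^+ 2 by rewrite s2.
  nra.
pose u := - y / (N%:R * (1 - p)); pose v := (y + 1) / (N%:R * p).
have [u1 u2] : `|u| <= 1 / 2 /\ 2 * u ^+ 2 <= 4 * D.
  by apply: bnd; [rewrite normrN (le_trans yA) // lerDl|lra].
have [v1 v2] : `|v| <= 1 / 2 /\ 2 * v ^+ 2 <= 4 * D by apply: bnd => //; lra.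
have v10 : 0 < 1 + v by move: v1; rewrite ler_norml => /andP[? ?]; lra.
have u10 : 0 < 1 + u by move: u1; rewrite ler_norml => /andP[? ?]; lra.
have Npy : 0 < N%:R * p + (y + 1).
  have -> : N%:R * p + (y + 1) = N%:R * p * (1 + v).
    by rewrite mulrDr mulr1 [N%:R * p * v]mulrC /v divfK // gt_eqF.
  exact: mulr_gt0.
have [N00 p00 q00] : [/\ N%:R != 0 :> R, p != 0 & 1 - p != 0].
  by split; rewrite gt_eqF //; lra.
have rE : r = (1 + u) / (1 + v).
  rewrite rdef /u /v; field.
  by rewrite N00 p00 q00 gt_eqF.
have uvE : u - v = q - 1 / (2 * (N%:R * p)) + 1 / (2 * (N%:R * (1 - p))).
  rewrite qdef /u /v; field.
  by rewrite N00 p00 q00.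
have small c : a <= c -> 0 <= 1 / (2 * (N%:R * c)) <= D.
  move=> ac; have c0' : 0 < c := lt_le_trans a0' ac.
  have N0' : 0 < N%:R :> R := lt_le_trans ltr01 NR.
  have c0 : 0 < N%:R * c by exact: mulr_gt0.
  rewrite divr_ge0 ?mulr_ge0 ?(ltW c0) ?(ltW c0') //=.
  have a2N : 0 < a ^+ 2 * N%:R by rewrite mulr_gt0 ?exprn_gt0 //; lra.
  apply: (@le_trans _ _ (1 / (a ^+ 2 * N%:R))); last first.
    by rewrite ler_wpM2r ?invr_ge0 ?(ltW a2N) // lerDr sqr_ge0.
  rewrite !div1r lef_pV2 ?posrE ?mulr_gt0 //.
  have -> : 2 * (N%:R * c) = 2 * c * N%:R by ring.
  rewrite ler_wpM2r //.
  have : a ^+ 2 <= a by rewrite exprS expr1 ler_piMr // ltW.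
  lra.
have /andP[sp0 sp1] := small p ap.
have /andP[sq0 sq1] : 0 <= 1 / (2 * (N%:R * (1 - p))) <= D by apply: small; lra.
rewrite rE stepD; apply/andP; split.
  apply: (@le_trans _ _ (expR (u - 2 * u ^+ 2) / expR v)).
    by rewrite -expRN -expRD ler_expR; lra.
  apply: ler_pM; rewrite ?expR_ge0 ?invr_ge0 ?expR_ge0 ?expR_le_1Dx //.
  by rewrite lef_pV2 ?posrE ?expR_gt0 // expR_ge1Dx.
apply: (@le_trans _ _ (expR u / expR (v - 2 * v ^+ 2))); last first.
  by rewrite -expRN -expRD ler_expR; lra.
apply: ler_pM; rewrite ?invr_ge0 ?(ltW v10) ?(ltW u10) ?expR_ge1Dx //.
by rewrite lef_pV2 ?posrE ?expR_gt0 // expR_le_1Dx.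
Qed.

End binomial_step.

(** On the interval from w to w + h the square of the variable differs from w
    ^ 2 by at most 2 h (A + 1). *)
Lemma normal_cell_bounds {R : realType} (w h A : R) : 0 <= h -> h <= 1 -> `|w| <= A ->
  let c := normal_peak 1 * expR (- w ^+ 2 / 2) in
  c * expR (- (h * (A + 1))) * h <= normal_cdf (w + h) - normal_cdf w
    <= c * expR (h * (A + 1)) * h.
Proof.
move=> h0 h1; rewrite ler_norml => /andP[w1 w2].
have peak0 : 0 <= normal_peak 1 :> R := normal_peak_ge0 1.
have wh : w <= w + h by lra.
set l : R := normal_peak 1 * expR (- w ^+ 2 / 2) * expR (- (h * (A + 1))).
set u : R := normal_peak 1 * expR (- w ^+ 2 / 2) * expR (h * (A + 1)).
have l0 : 0 <= l by rewrite !mulr_ge0 ?expR_ge0.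
have bnd z : w <= z <= w + h -> l <= normal_pdf 0 1 z <= u.
  move=> /andP[z1 z2]; rewrite normal_pdf01E /l /u -!mulrA !ler_wpM2l //=;
  by rewrite -expRD ler_expR; nra.
have := @normal_cdf_sub_bounds R w (w + h) l u wh l0 bnd.
by rewrite addrAC subrr add0r.
Qed.

Section window.
Context {R : realType}.
Implicit Types (a A p : R) (N k : nat).

Definition std_dev N p : R := Num.sqrt (N%:R * p * (1 - p)).

Definition standardize N p k : R := (k%:R - N%:R * p) / std_dev N p.

Lemma binomial_pmfE N p k :
  binomial_pmf N p k = p ^+ k * (1 - p) ^+ (N - k) * 'C(N, k)%:R.
Proof. by rewrite /binomial_pmf -mulr_natr. Qed.

Lemma binomial_pmfS N p k : (k < N)%N -> 1 - p != 0 ->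
  binomial_pmf N p k.+1 = binomial_pmf N p k *
    ((N%:R - k%:R) * p / ((k%:R + 1) * (1 - p))).
Proof.
move=> kN q0; rewrite !binomial_pmfE.
have e : (k%:R + 1) * 'C(N, k.+1)%:R = (N%:R - k%:R) * 'C(N, k)%:R :> R.
  by rewrite -natrB ?(ltnW kN) // natr1 -!natrM mul_bin_left.
have k10 : k%:R + 1 != 0 :> R by rewrite natr1 pnatr_eq0.
have -> : 'C(N, k.+1)%:R = (N%:R - k%:R) * 'C(N, k)%:R / (k%:R + 1) :> R.
  by rewrite -e mulrC mulKf.
have -> : (N - k = (N - k.+1).+1)%N by rewrite subnSK.
by rewrite !exprS; field; rewrite q0 k10.
Qed.

(** By binomial_ratio the quotients of the binomial probabilities by exp(- x
    ^ 2 / 2) change by at most a factor exp(step_error) from one k to the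
    next. Multiply these factors along the window, then replace the values
    exp(- x ^ 2 / 2) by the normal measures of the cells, which costs the
    second part of E. *)
Lemma window_comparison a A p N i j : 0 < a -> 0 <= A -> a <= p <= 1 - a ->
  (0 < N)%N -> (A * Num.sqrt N%:R + 1) / (a * N%:R) <= 1 / 2 -> (j <= N)%N ->
  (std_dev N p)^-1 <= 1 ->
  (forall k, (i <= k < j)%N -> `|standardize N p k| <= A) ->
  let cell k := normal_cdf (standardize N p k.+1) - normal_cdf (standardize N p k) in
  let E := expR (step_error a A N * (j - i)%:R + 2 * ((std_dev N p)^-1 * (A + 1))) in
  forall k l, (i <= k < j)%N -> (i <= l < j)%N ->
  binomial_pmf N p k * cell l <= E * (binomial_pmf N p l * cell k).
Proof.
move=> a0 A0 pa N0 largeN jN sd1 win cell E.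
have /andP[ap pa1] := pa.
have NR : 1 <= N%:R :> R by rewrite ler1n.
have p0 : 0 < p by lra.
have q0 : 0 < 1 - p by lra.
set sd := std_dev N p in sd1 E *.
have var0 : 0 < N%:R * p * (1 - p) by rewrite !mulr_gt0 //; lra.
have sd0 : 0 < sd by rewrite sqrtr_gt0.
have sd2 : sd ^+ 2 = N%:R * p * (1 - p) by rewrite sqr_sqrtr // ltW.
have sdN : sd <= Num.sqrt N%:R.
  rewrite ler_wsqrtr // -mulrA ler_piMr //; nra.
pose x k := standardize N p k; pose psi k : R := expR (- x k ^+ 2 / 2).
pose b k := binomial_pmf N p k; pose rho k := b k / psi k.
have psi0 k : 0 < psi k by exact: expR_gt0.
have b0 k : 0 <= b k by apply: binomial_pmf_ge0; lra.
have rho0 k : 0 <= rho k by rewrite divr_ge0 // ltW.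
have kap0 : 0 <= step_error a A N.
  by rewrite /step_error divr_ge0 ?mulr_ge0 ?addr_ge0 ?sqr_ge0 ?exprn_ge0 ?(ltW a0).
have e1 : 1 <= expR (step_error a A N) by rewrite -expR0 ler_expR.
have chain k : (i <= k)%N -> (k.+1 < j)%N ->
    rho k <= expR (step_error a A N) * rho k.+1 /\
    rho k.+1 <= expR (step_error a A N) * rho k.
  move=> ik kj.
  have kN : (k < N)%N by exact: leq_trans (ltnW kj) jN.
  pose y : R := k%:R - N%:R * p.
  have xk : x k = y / sd by [].
  have yA : `|y| <= A * Num.sqrt N%:R.
    have := win k; rewrite ik (ltnW kj) => /(_ isT).
    rewrite /standardize -/y -/sd normrM normfV (gtr0_norm sd0) ler_pdivrMr // => h.
    by apply: (le_trans h); rewrite ler_wpM2l.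
  have y1A : `|y + 1| <= A * Num.sqrt N%:R + 1.
    by apply: le_trans (ler_normD _ _) _; rewrite normr1 lerD2r.
  set r := (N%:R - k%:R) * p / ((k%:R + 1) * (1 - p)).
  set q := - (2 * y + 1) / (2 * (N%:R * p * (1 - p))).
  have rE : r = (N%:R * (1 - p) - y) * p / ((N%:R * p + y + 1) * (1 - p)).
    rewrite /r /y; congr (_ * _ / (_ * _)); ring.
  have /andP[r1 r2] := binomial_ratio a0 A0 pa N0 largeN yA y1A rE erefl.
  rewrite -/q in r1 r2.
  have bS : b k.+1 = b k * r by apply: binomial_pmfS => //; rewrite gt_eqF.
  have psiS : psi k.+1 = psi k * expR q.
    rewrite /psi -expRD; congr expR.
    have -> : x k.+1 = (y + 1) / sd by rewrite /x /standardize -/sd /y -natr1; congr (_ / _); ring.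
    rewrite xk !exprMn exprVn sd2 /q; field.
    by rewrite !gt_eqF //; lra.
  have rhoS : rho k.+1 = rho k * (r * expR (- q)).
    by rewrite /rho bS psiS expRN; field; rewrite !gt_eqF ?expR_gt0.
  have r1' : 1 <= expR (step_error a A N) * (r * expR (- q)).
    rewrite mulrA -ler_pdivrMr ?expR_gt0 // -expRN opprK mul1r mulrC.
    by rewrite -ler_pdivrMr ?expR_gt0 // -expRN -expRD.
  have r2' : r * expR (- q) <= expR (step_error a A N).
    rewrite -ler_pdivlMr ?expR_gt0 // -expRN opprK -expRD addrC //.
  split; last by rewrite rhoS mulrC ler_wpM2r.
  rewrite rhoS mulrCA -[leLHS]mulr1 ler_wpM2l //.
have hchain := geometric_chain e1 rho0 chain.
move=> k l kij lij.
have hkl : rho k <= expR (step_error a A N * (j - i)%:R) * rho l.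
  by rewrite [_ * _%:R]mulrC expRM_natl; exact: hchain.
pose c := normal_peak 1 : R.
have c0 : 0 < c by rewrite normal_peak_gt0 // oner_neq0.
have sdi0 : 0 < sd^-1 by rewrite invr_gt0.
have cellE n : cell n = normal_cdf (x n + sd^-1) - normal_cdf (x n).
  congr (normal_cdf _ - _); rewrite /x /standardize -/sd -natr1; ring.
have /andP[_ gl] := normal_cell_bounds (ltW sdi0) sd1 (win l lij).
have /andP[gk _] := normal_cell_bounds (ltW sdi0) sd1 (win k kij).
rewrite -/(x k) -/(psi k) in gk; rewrite -/(x l) -/(psi l) in gl.
rewrite -!cellE -/c in gl gk.
set hA := sd^-1 * (A + 1) in E gl gk *.
have bE n : binomial_pmf N p n = rho n * psi n by rewrite /rho divfK // gt_eqF.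
rewrite !bE.
apply: (@le_trans _ _ (expR (step_error a A N * (j - i)%:R) * rho l * psi k *
    (c * psi l * expR hA * sd^-1))).
  rewrite ler_pM //.
  - by rewrite mulr_ge0 // ltW.
  - by rewrite cellE subr_ge0 normal_cdf_nd // lerDl ltW.
  - by rewrite ler_wpM2r ?(ltW (psi0 k)).
have -> : E = expR (step_error a A N * (j - i)%:R) * expR hA * expR hA.
  by rewrite /E -!expRD; congr expR; ring.
apply: (@le_trans _ _ (expR (step_error a A N * (j - i)%:R) * expR hA * expR hA *
    (rho l * psi l * (c * psi k * expR (- hA) * sd^-1)))).
  rewrite le_eqVlt; apply/orP; left; apply/eqP.
  by rewrite expRN; field; rewrite !gt_eqF ?expR_gt0.
rewrite ler_wpM2l ?mulr_ge0 ?expR_ge0 // ler_wpM2l // mulr_ge0 // ltW //.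
Qed.

End window.

Section binomial_tails.
Context {R : realType} (N : nat) (p : R).

Lemma sum_binomial_pmf (f : nat -> R) :
  \sum_(k < N.+1) binomial_pmf N p k * f k =
  \sum_(G : {set 'I_N}) bernoulli_set p G * f #|G|.
Proof. by rewrite sum_bernoulli_set_card card_ord. Qed.

Lemma sum_binomial_pmf1 : \sum_(k < N.+1) binomial_pmf N p k = 1.
Proof.
under eq_bigr do rewrite -[binomial_pmf _ _ _]mulr1.
rewrite (sum_binomial_pmf (fun=> 1)).
by under eq_bigr do rewrite mulr1; exact: sum_bernoulli_set.
Qed.

Lemma binomial_chebyshev (A : R) : 0 < A -> 0 <= p <= 1 -> 0 < std_dev N p ->
  \sum_(k < N.+1 | A <= `|standardize N p k|) binomial_pmf N p k <= 1 / A ^+ 2.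
Proof.
move=> A0 p01 sd0.
have sd2 : std_dev N p ^+ 2 = N%:R * p * (1 - p).
  by rewrite sqr_sqrtr // ltW // -sqrtr_gt0.
have b0 k : 0 <= binomial_pmf N p k by exact: binomial_pmf_ge0.
rewrite ler_pdivlMr ?exprn_gt0 //.
apply: (@le_trans _ _ (\sum_(k < N.+1) binomial_pmf N p k * standardize N p k ^+ 2)).
  rewrite mulr_suml big_mkcond /=; apply: ler_sum => k _; case: ifP => [h|_].
    by rewrite ler_wpM2l // -[leRHS]real_normK ?num_real // lerXn2r ?nnegrE // ltW.
  by rewrite mulr_ge0 // sqr_ge0.
rewrite (eq_bigr (fun k : 'I_N.+1 =>
    binomial_pmf N p k * (k%:R - N%:R * p) ^+ 2 / std_dev N p ^+ 2)); last first.
  by move=> k _; rewrite /standardize exprMn exprVn mulrA.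
rewrite -mulr_suml (sum_binomial_pmf (fun k => (k%:R - N%:R * p) ^+ 2)).
rewrite -[in N%:R](card_ord N) variance_bernoulli_set card_ord sd2 divff //.
by rewrite -sd2 expf_neq0 // gt_eqF.
Qed.

End binomial_tails.

Section de_moivre_laplace.
Context {R : realType}.
Implicit Types (a A p x y e : R) (N k : nat).

(** The first k whose standardized value exceeds y; see ltn_cut. *)
Definition cut N p y : nat := (Num.trunc (N%:R * p + y * std_dev N p)).+1.

Lemma ltn_cut N p y k : 0 <= N%:R * p + y * std_dev N p ->
  (k < cut N p y)%N = (k%:R <= N%:R * p + y * std_dev N p).
Proof. by move=> h; rewrite /cut ltnS truncn_ge_nat. Qed.

Lemma standardize_le N p y k : 0 < std_dev N p ->
  (standardize N p k <= y) = (k%:R <= N%:R * p + y * std_dev N p).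
Proof. by move=> h; rewrite /standardize ler_pdivrMr // lerBlDl. Qed.

Lemma cut_gt N p y : 0 < std_dev N p -> y < standardize N p (cut N p y).
Proof.
by move=> h; rewrite ltNge standardize_le // -ltNge truncnS_gt.
Qed.

Lemma cut_le N p y : 0 < std_dev N p -> 0 <= N%:R * p + y * std_dev N p ->
  standardize N p (cut N p y) <= y + (std_dev N p)^-1.
Proof.
move=> h h0; rewrite standardize_le // mulrDl mulVf ?gt_eqF // addrA -natr1 lerD2r.
by rewrite truncn_le.
Qed.

Lemma cut_mono N p y y' : 0 < std_dev N p -> y <= y' -> (cut N p y <= cut N p y')%N.
Proof.
by move=> h yy'; rewrite ltnS le_truncn // lerD2l ler_wpM2r // ltW.
Qed.

Lemma sum_comparison (b c : nat -> R) (E : R) (i j1 j : nat) :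
  (j1 <= j)%N -> (forall k l, (i <= k < j)%N -> (i <= l < j)%N ->
     b k * c l <= E * (b l * c k)) ->
  (\sum_(i <= k < j1) b k) * (\sum_(i <= k < j) c k) <=
  E * ((\sum_(i <= k < j) b k) * (\sum_(i <= k < j1) c k)).
Proof.
move=> j1j h; rewrite [X in E * X]mulrC !big_distrlr /= mulr_sumr.
apply: ler_sum_nat => k /andP[ik kj].
rewrite mulr_sumr; apply: ler_sum_nat => l il.
rewrite [c k * b l]mulrC; apply: h => //.
by rewrite ik (leq_trans kj).
Qed.

(** The conditions under which the errors across the window are small, in
    terms of s = sqrt N and n = N; each of the errors is bounded by a
    multiple of 1 / (a ^ 2 s). *)
Lemma window_numerics (a A kap s n : R) : 0 < a -> a <= 1 / 2 -> 1 <= A ->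
  0 < kap -> kap <= 1 / 4 -> 1 <= s -> s ^+ 2 = n ->
  12 * (A + 1) * (A ^+ 2 + 1) / a ^+ 2 <= kap * s ->
  [/\ (A * s + 1) / (a * n) <= 1 / 2, A * s + 1 < a * n, 1 / (a * s) <= kap &
   5 * (A ^+ 2 + 1) / (a ^+ 2 * n) * (2 * A * s + 1) + 2 * (1 / (a * s) * (A + 1)) <= kap].
Proof.
move=> a0 a2 A1 k0 k4 s1 s2 big.
have s0 : 0 < s by lra.
have n0 : 0 < n by rewrite -s2 exprn_gt0.
have AA : 1 <= A ^+ 2 by rewrite exprn_ege1.
set w := 1 / (a ^+ 2 * s).
have w0 : 0 < w by rewrite divr_gt0 // mulr_gt0 ?exprn_gt0.
pose B := (A + 1) * (A ^+ 2 + 1).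
have AB : A + 1 <= B by rewrite ler_peMr //; lra.
have B0 : 0 <= B by lra.
have bigw : 12 * (B * w) <= kap.
  have -> : 12 * (B * w) = 12 * (A + 1) * (A ^+ 2 + 1) / a ^+ 2 / s.
    by rewrite /B /w; field; rewrite !gt_eqF.
  by rewrite ler_pdivrMr.
have aw : 1 / (a * s) <= w.
  rewrite /w !div1r lef_pV2 ?posrE ?mulr_gt0 ?exprn_gt0 // ler_wpM2r ?(ltW s0) //.
  by rewrite expr2 ler_piMl //; lra.
have aw0 : 0 <= 1 / (a * s) by rewrite divr_ge0 // mulr_ge0 ?(ltW a0) ?(ltW s0).
have Bw : (A + 1) * w <= B * w by rewrite ler_wpM2r // ltW.
have w2 : 2 * w <= (A + 1) * w by rewrite ler_wpM2r ?(ltW w0) //; lra.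
have Aaw : (A + 1) * (1 / (a * s)) <= (A + 1) * w by rewrite ler_wpM2l //; lra.
have h1 : (A * s + 1) / (a * n) <= (A + 1) * (1 / (a * s)).
  have -> : (A + 1) * (1 / (a * s)) = ((A + 1) * s) / (a * n).
    by rewrite -s2; field; rewrite !gt_eqF.
  by rewrite ler_wpM2r ?invr_ge0 ?mulr_ge0 ?(ltW a0) ?(ltW n0) //; lra.
split.
- by lra.
- by rewrite -[ltRHS]mul1r -ltr_pdivrMr ?mulr_gt0 //; lra.
- by lra.
- have -> : 5 * (A ^+ 2 + 1) / (a ^+ 2 * n) * (2 * A * s + 1) =
     5 * ((A ^+ 2 + 1) * ((2 * A * s + 1) / s)) * w.
    by rewrite /w -s2; field; rewrite !gt_eqF.
  have h2 : (2 * A * s + 1) / s <= 2 * (A + 1) by rewrite ler_pdivrMr //; lra.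
  have h3 : (A ^+ 2 + 1) * ((2 * A * s + 1) / s) <= 2 * B.
    have -> : 2 * B = (A ^+ 2 + 1) * (2 * (A + 1)) by rewrite /B; ring.
    by rewrite ler_wpM2l //; lra.
  have h4 : (A ^+ 2 + 1) * ((2 * A * s + 1) / s) * w <= 2 * B * w.
    by rewrite ler_wpM2r // ltW.
  lra.
Qed.

(** The proportions S1 / S and G1 / G agree up to the factor E, and S, G and
    E are 1 up to O(e). *)
Lemma proportion_bounds (S1 S G1 G L B E e : R) :
  0 < e -> e <= 1 / 4 -> 0 <= L -> L <= e -> B = L + S1 -> 1 - e <= S -> S <= 1 ->
  0 <= S1 -> 0 <= G1 -> G1 <= G -> 1 - 2 * e <= G -> G <= 1 -> 1 <= E -> E <= 1 + e ->
  S1 * G <= E * (S * G1) -> G1 * S <= E * (G * S1) ->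
  G1 - 2 * e <= B <= G1 + 7 * e.
Proof.
move=> e0 e4 L0 Le -> S_ S1_ S10 G10 G1G G_ G_1 E1 Ee h1 h2.
have G11 : G1 <= 1 by lra.
have k1 : S1 * G <= (1 + e) * G1.
  apply: (le_trans h1); apply: ler_pM; rewrite ?mulr_ge0 //; try lra.
  by rewrite ler_piMl.
have k2 : G1 * (1 - e) <= (1 + e) * S1.
  apply: (@le_trans _ _ (G1 * S)); first by rewrite ler_wpM2l.
  apply: (le_trans h2); apply: ler_pM; rewrite ?mulr_ge0 //; try lra.
  by rewrite ler_piMl //; lra.
have k3 : S1 * (1 - 2 * e) <= S1 * G by rewrite ler_wpM2l.
apply/andP; split; first by nra.
suff : S1 <= G1 + 6 * e by lra.
rewrite -(@ler_pM2r _ (1 - 2 * e)); last by lra.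
apply: (le_trans k3); apply: (le_trans k1).
have : e * G1 <= e by rewrite ler_piMr // ltW.
have : e * e <= e * (1 / 4) by rewrite ler_wpM2l // ltW.
lra.
Qed.

(** The factor exp(kap) collects the errors of the at most 2 A s + 1 steps
    across the window and the variation of the normal density on one cell. *)
Lemma binomial_window a A x kap p N :
  0 < a -> a <= p <= 1 - a -> (0 < N)%N -> 1 <= A -> `|x| <= A ->
  0 < kap -> kap <= 1 / 4 ->
  12 * (A + 1) * (A ^+ 2 + 1) / a ^+ 2 <= kap * Num.sqrt N%:R ->
  let i := cut N p (- A) in let j := cut N p A in
  let cell k := normal_cdf (standardize N p k.+1) - normal_cdf (standardize N p k) in
  [/\ 0 < std_dev N p /\ (std_dev N p)^-1 <= kap, (i <= cut N p x <= j)%N, (j <= N)%N,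
    forall y, `|y| <= A -> 0 <= N%:R * p + y * std_dev N p &
    forall k l, (i <= k < j)%N -> (i <= l < j)%N ->
      binomial_pmf N p k * cell l <= expR kap * (binomial_pmf N p l * cell k)].
Proof.
move=> a0 pa N0 A1 xA kap0 k4 big i j cell.
have /andP[ap pa1] := pa.
have NR : 1 <= N%:R :> R by rewrite ler1n.
set s := Num.sqrt N%:R : R in big *.
have s2 : s ^+ 2 = N%:R by rewrite sqr_sqrtr.
have s1 : 1 <= s by rewrite -[leLHS]sqrtr1 ler_wsqrtr.
have s0 : 0 < s by lra.
have [p0 q0] : 0 < p /\ 0 < 1 - p by split; lra.
have var0 : 0 < N%:R * p * (1 - p) by rewrite !mulr_gt0 //; lra.
set sd := std_dev N p.
have sd0 : 0 < sd by rewrite sqrtr_gt0.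
have sd2 : sd ^+ 2 = N%:R * p * (1 - p) by rewrite sqr_sqrtr // ltW.
have sds : sd <= s by rewrite ler_wsqrtr // -mulrA ler_piMr //; nra.
have assd : a * s <= sd.
  rewrite -(@ler_pXn2r _ 2) ?nnegrE ?(ltW sd0) ?mulr_ge0 ?(ltW a0) ?(ltW s0) //.
  rewrite exprMn s2 sd2 mulrC -mulrA ler_wpM2l //; last by rewrite expr2 ler_pM //; lra.
have a2 : a <= 1 / 2 by lra.
have [largeN As1 hk totk] := window_numerics a0 a2 A1 kap0 k4 s1 s2 big.
have h0 : 0 < sd^-1 by rewrite invr_gt0.
have hle : sd^-1 <= 1 / (a * s) by rewrite div1r lef_pV2 ?posrE ?mulr_gt0.
have he : sd^-1 <= kap := le_trans hle hk.
have Asd : A * sd <= A * s by rewrite ler_wpM2l //; lra.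
have aNp : a * N%:R <= N%:R * p by rewrite mulrC ler_wpM2l.
have aNq : a * N%:R <= N%:R * (1 - p) by rewrite mulrC ler_wpM2l //; lra.
have nn y : `|y| <= A -> 0 <= N%:R * p + y * sd.
  rewrite ler_norml => /andP[y1 _].
  have : - A * sd <= y * sd by rewrite ler_wpM2r // ltW.
  lra.
have AA : `|A| <= A by rewrite ger0_norm //; lra.
have AnA : `|- A| <= A by rewrite normrN.
pose jx := cut N p x.
have [xA1 xA2] : - A <= x /\ x <= A by move: xA; rewrite ler_norml => /andP.
have ij : (i <= jx)%N by exact: cut_mono.
have jj : (jx <= j)%N by exact: cut_mono.
have jN : (j <= N)%N.
  by rewrite /j /cut truncn_lt_nat ?nn // -/sd; clear -As1 Asd aNq; lra.
have win k : (i <= k < j)%N -> - A < standardize N p k <= A.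
  move=> /andP[ik kj]; rewrite standardize_le // -ltn_cut ?nn // kj andbT.
  by rewrite ltNge standardize_le // -ltn_cut ?nn // -leqNgt.
have win' k : (i <= k < j)%N -> `|standardize N p k| <= A.
  by move=> /win /andP[k1 k2]; rewrite ler_norml (ltW k1).
pose b k := binomial_pmf N p k.
have b0 k : 0 <= b k by apply: binomial_pmf_ge0; rewrite (ltW p0) -subr_ge0 ltW.
have sd1 : sd^-1 <= 1 by rewrite (le_trans he) // (le_trans k4) //; clear; lra.
have Ap0 : 0 <= A + 1 by clear -A1; lra.
set E := expR kap.
have hE : expR (step_error a A N * (j - i)%:R + 2 * (sd^-1 * (A + 1))) <= E.
  rewrite ler_expR; apply: le_trans totk; apply: lerD; last first.
    by rewrite ler_wpM2l // ler_wpM2r.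
  rewrite ler_wpM2l //; first by rewrite /step_error divr_ge0 ?mulr_ge0 ?addr_ge0 ?sqr_ge0 ?exprn_ge0 ?(ltW a0).
  apply: (@le_trans _ _ (2 * A * sd + 1)); last by clear -Asd; lra.
  have [ji|ij'] := leqP j i.
    have -> : (j - i = 0)%N by apply/eqP; rewrite subn_eq0.
    have : 0 <= A * sd by rewrite mulr_ge0 ?(ltW sd0) // (le_trans ler01).
    by clear; lra.
  rewrite natrB ?(ltnW ij') //.
  have hi : N%:R * p - A * sd < i%:R.
    have := cut_gt (- A) sd0; rewrite ltNge standardize_le // -ltNge -/sd -/i.
    by clear; lra.
  have hj : j%:R <= N%:R * p + A * sd + 1.
    by rewrite /j /cut -natr1 lerD2r truncn_le -/sd nn.
  by clear -hi hj; lra.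
have cell0 k : 0 <= cell k.
  rewrite /cell subr_ge0 normal_cdf_nd // /standardize ler_wpM2r //.
    exact: ltW h0.
  by rewrite lerD2r ler_nat.
split => // [|k l kij lij]; first by rewrite ij jj.
apply: (le_trans (window_comparison a0 (le_trans ler01 A1) pa N0 largeN jN sd1 win' kij lij)).
by apply: ler_wpM2r; [exact: mulr_ge0 (b0 l) (cell0 k)|exact: hE].
Qed.

(** By binomial_window the binomial probabilities in the window are nearly
    proportional to the normal measures of the cells. Both distributions give
    the window a probability close to 1, so the proportionality is nearly an
    equality; what lies below the window is small by Chebyshev's inequality. *)
Lemma binomial_window_estimate a A x e kap p N :
  0 < a -> a <= p <= 1 - a -> (0 < N)%N -> 1 <= A -> `|x| <= A ->
  0 < e -> e <= 1 / 4 -> normal_cdf (- A + 1) <= e -> 1 - e <= normal_cdf A ->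
  1 / A ^+ 2 <= e -> 0 < kap -> kap <= e -> expR kap <= 1 + e ->
  12 * (A + 1) * (A ^+ 2 + 1) / a ^+ 2 <= kap * Num.sqrt N%:R ->
  normal_cdf x - 3 * e <=
    \sum_(k < N.+1 | k%:R <= N%:R * p + x * std_dev N p) binomial_pmf N p k
    <= normal_cdf (x + e) + 7 * e.
Proof.
move=> a0 pa N0 A1 xA e0 e4 FA1 FA2 Ae kap0 kape Ekap big.
have [[sd0 hk] /andP[ij jj] jN nn hcomp] :=
  binomial_window a0 pa N0 A1 xA kap0 (le_trans kape e4) big.
have p01 : 0 <= p <= 1 by move: pa => /andP[? ?]; apply/andP; split; lra.
clear big a0 pa; set sd := std_dev N p in sd0 hk nn *.
have he : sd^-1 <= e := le_trans hk kape.
have AA : `|A| <= A by rewrite ger0_norm // (le_trans ler01).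
have AnA : `|- A| <= A by rewrite normrN.
pose b k := binomial_pmf N p k.
have b0 k : 0 <= b k by exact: binomial_pmf_ge0.
set i := cut N p (- A) in ij hcomp; set jx := cut N p x in ij jj; set j := cut N p A in jj jN hcomp.
pose cell k := normal_cdf (standardize N p k.+1) - normal_cdf (standardize N p k).
set E := expR kap in Ekap hcomp.
have cell0 k : 0 <= cell k.
  rewrite /cell subr_ge0 normal_cdf_nd // /standardize ler_wpM2r //.
    by rewrite invr_ge0 ltW.
  by rewrite lerD2r ler_nat.
have hcomp' k l : (i <= k < j)%N -> (i <= l < j)%N -> cell k * b l <= E * (cell l * b k).
  by move=> kij lij; rewrite mulrC [cell l * _]mulrC; exact: hcomp.
have c1 := sum_comparison jj hcomp; have c2 := sum_comparison jj hcomp'.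
set S1 := \sum_(i <= k < jx) b k in c1 c2; set S := \sum_(i <= k < j) b k in c1 c2.
set G1 := \sum_(i <= k < jx) cell k in c1 c2; set G := \sum_(i <= k < j) cell k in c1 c2.
have G1E : G1 = normal_cdf (standardize N p jx) - normal_cdf (standardize N p i).
  exact: (telescope_sumr (fun k => normal_cdf (standardize N p k)) ij).
have GE : G = normal_cdf (standardize N p j) - normal_cdf (standardize N p i).
  exact: (telescope_sumr (fun k => normal_cdf (standardize N p k)) (leq_trans ij jj)).
have Fi : normal_cdf (standardize N p i) <= e.
  apply: le_trans FA1; apply: normal_cdf_nd.
  by apply: (le_trans (cut_le sd0 (nn _ AnA))); rewrite lerD2l (le_trans he) // (le_trans e4) //; clear; lra.
have Fi0 := normal_cdf_ge0 (standardize N p i).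
have Fj : 1 - e <= normal_cdf (standardize N p j).
  by apply: (le_trans FA2); apply: normal_cdf_nd; apply: ltW; exact: cut_gt.
have Fj1 := normal_cdf_le1 (standardize N p j).
have Fjx : normal_cdf x <= normal_cdf (standardize N p jx) <= normal_cdf (x + e).
  rewrite !normal_cdf_nd //; last by apply: ltW; exact: cut_gt.
  by apply: (le_trans (cut_le sd0 (nn _ xA))); rewrite lerD2l.
have tail : \sum_(k < N.+1 | A <= `|standardize N p k|) b k <= e.
  by apply: le_trans Ae; apply: binomial_chebyshev => //; exact: lt_le_trans ltr01 A1.
have tail_le (P : pred nat) : (forall k, P k -> A <= `|standardize N p k|) ->
    \sum_(k < N.+1 | P k) b k <= e.
  move=> hP; apply: le_trans tail; rewrite big_mkcond [leRHS]big_mkcond /=.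
  by apply: ler_sum => k _; case: ifP => [/hP ->//|_]; case: ifP.
have NS m : (m <= N)%N -> (m <= N.+1)%N by move=> h; rewrite (leq_trans h).
set L := \sum_(0 <= k < i) b k.
have L0 : 0 <= L by rewrite sumr_ge0.
have Le : L <= e.
  rewrite /L (big_nat_widen _ _ N.+1) ?big_mkord /=; last by rewrite NS // (leq_trans ij) // (leq_trans jj).
  apply: (tail_le (fun k => k < i)%N) => k ki.
  have : standardize N p k <= - A by rewrite standardize_le // -ltn_cut ?nn.
  by rewrite -normrN => kA; rewrite (le_trans _ (ler_norm _)) // lerNr.
have S1' : S <= 1 /\ 1 - e <= S.
  have SE : S = \sum_(k < N.+1 | (i <= k < j)%N) b k.
    rewrite /S (big_nat_widen _ _ N.+1) ?NS // big_geq_mkord /=.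
    by apply: eq_bigl => k; rewrite andbC.
  have := sum_binomial_pmf1 N p; rewrite (bigID (fun k : 'I_N.+1 => (i <= k < j)%N)) /= -SE => tot.
  have t0 : 0 <= \sum_(k < N.+1 | ~~ (i <= k < j)%N) b k by rewrite sumr_ge0.
  have t1 : \sum_(k < N.+1 | ~~ (i <= k < j)%N) b k <= e.
    apply: (tail_le (fun k => ~~ (i <= k < j)%N)) => k.
    rewrite negb_and -ltnNge -leqNgt => /orP[ki|jk].
      have : standardize N p k <= - A by rewrite standardize_le // -ltn_cut ?nn.
      by rewrite -normrN => kA; rewrite (le_trans _ (ler_norm _)) // lerNr.
    have : A < standardize N p k by rewrite ltNge standardize_le // -ltn_cut ?nn // -leqNgt.
    by move=> /ltW kA; rewrite (le_trans kA) // ler_norm.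
  by rewrite -/b in tot; clear -tot t0 t1; split; lra.
have BE : \sum_(k < N.+1 | k%:R <= N%:R * p + x * sd) b k = L + S1.
  rewrite /L /S1 -big_cat_nat //= (big_nat_widen _ _ N.+1) ?big_mkord /=; last first.
    by rewrite NS // (leq_trans jj).
  by apply: eq_bigl => k; rewrite ltn_cut ?nn.
have G1G : G1 <= G.
  rewrite /G (big_cat_nat ij jj) /= lerDl sumr_ge0 //.
have [S10 G10] : 0 <= S1 /\ 0 <= G1 by split; rewrite sumr_ge0.
have E1 : 1 <= E by rewrite -expR0 ler_expR ltW.
clearbody G G1 S S1 L E.
move: (normal_cdf (standardize N p jx)) (normal_cdf (standardize N p i))
  (normal_cdf (standardize N p j)) G1E GE Fi Fi0 Fj Fj1 Fjx => Fx Fl Fr G1E GE Fi Fi0 Fj Fj1.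
move=> /andP[f1 f2]; have [G_ge G_le] : 1 - 2 * e <= G /\ G <= 1.
  by clear -GE Fi Fi0 Fj Fj1; split; lra.
have /andP[l1 l2] := proportion_bounds e0 e4 L0 Le BE S1'.2 S1'.1 S10 G10 G1G G_ge G_le
  E1 Ekap c1 c2.
apply/andP; split.
  by apply: le_trans l1; clear -f1 G1E Fi; lra.
by apply: (le_trans l2); clear -f2 G1E Fi0; lra.
Qed.

End de_moivre_laplace.

(** The slack eps in the argument makes the statement insensitive to the
    lattice on which the binomial distribution lives. The bound N0 must not
    depend on p, since p varies with N in the application. *)
Lemma de_moivre_laplace {R : realType} (a x eps : R) : 0 < a -> 0 < eps ->
  exists N0 : nat, forall N, (N0 <= N)%N -> forall p, a <= p <= 1 - a ->
  normal_cdf (x - eps) - eps <=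
    \sum_(k < N.+1 | k%:R <= N%:R * p + x * std_dev N p) binomial_pmf N p k
    <= normal_cdf (x + eps) + eps.
Proof.
move=> a0 eps0.
have [e [e0 e4 e8]] : exists e : R, [/\ 0 < e, e <= 1 / 4 & 8 * e <= eps].
  exists (Num.min (eps / 8) (1 / 4)); split.
  - by rewrite lt_min !divr_gt0.
  - by rewrite ge_min lexx orbT.
  - by rewrite -ler_pdivlMl // mulrC ge_min lexx.
have [kap [kap0 kape Ekap]] : exists k : R, [/\ 0 < k, k <= e & expR k <= 1 + e].
  exists (Num.min e (ln (1 + e))); split.
  - by rewrite lt_min e0 ln_gt0 // ltrDl.
  - by rewrite ge_min lexx.
  - have {2}-> : 1 + e = expR (ln (1 + e)) by rewrite lnK // posrE addr_gt0.
    by rewrite ler_expR ge_min lexx orbT.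
have [A0 tails] := normal_cdf_tails e0.
(* 1 <= A and 1 / e <= A give 1 / A ^ 2 <= e; A0 <= A - 1 leaves room for the length
   of one cell, which is at most 1. *)
pose A := `|A0| + `|x| + 1 / e + 1.
have ie0 : 0 < 1 / e by rewrite divr_gt0.
have [n1 n2 n3] : [/\ 0 <= `|A0|, 0 <= `|x| & A0 <= `|A0| ] by rewrite !normr_ge0 ler_norm.
have [A1 xA AA1 AA0 Ae] : [/\ 1 <= A, `|x| <= A, A0 <= A - 1, A0 <= A & 1 / e <= A].
  by rewrite /A; split; lra.
have FA1 : normal_cdf (- A + 1) <= e.
  by have [h _] := tails _ AA1; rewrite opprB addrC in h.
have [_ FA2] := tails _ AA0.
have Ae2 : 1 / A ^+ 2 <= e.
  rewrite ler_pdivrMr ?exprn_gt0 ?(lt_le_trans ltr01) //.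
  have : 1 <= e * A by rewrite mulrC -ler_pdivrMr.
  rewrite expr2 mulrA => h; apply: (le_trans h); rewrite ler_peMr //.
  by rewrite (le_trans _ h).
pose K := 12 * (A + 1) * (A ^+ 2 + 1) / a ^+ 2 / kap.
exists (Num.bound (K ^+ 2)).+1 => N hN p pa.
have N0 : (0 < N)%N by exact: leq_trans hN.
have big : 12 * (A + 1) * (A ^+ 2 + 1) / a ^+ 2 <= kap * Num.sqrt N%:R.
  rewrite [leRHS]mulrC -ler_pdivrMr // -/K.
  apply: (@le_trans _ _ (Num.sqrt (K ^+ 2))); first by rewrite sqrtr_sqr ler_norm.
  rewrite ler_wsqrtr // ltW // (lt_le_trans (archi_boundP (sqr_ge0 K))) //.
  by rewrite ler_nat ltnW.
have := binomial_window_estimate a0 pa N0 A1 xA e0 e4 FA1 FA2 Ae2 kap0 kape Ekap big.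
move=> /andP[h1 h2].
have m1 : normal_cdf (x - eps) <= normal_cdf x.
  by rewrite normal_cdf_nd //; clear -eps0; lra.
have m2 : normal_cdf (x + e) <= normal_cdf (x + eps).
  by rewrite normal_cdf_nd //; clear -e0 e8; lra.
clear -h1 h2 m1 m2 e0 e8; by apply/andP; split; lra.
Qed.

(** * The mean number of factors as a function of the number of edges *)

Lemma ln1D_bounds {R : realType} (u : R) : `|u| <= 1 / 2 ->
  u - 2 * u ^+ 2 <= ln (1 + u) <= u.
Proof.
move=> u2; have u0 : 0 < 1 + u by move: u2; rewrite ler_norml => /andP[? _]; lra.
apply/andP; split.
  by rewrite -ler_expR lnK ?posrE // expR_le_1Dx.
by rewrite -ler_expR lnK ?posrE // expR_ge1Dx.
Qed.

Lemma ln_prod {R : realType} (n : nat) (F : 'I_n -> R) : (forall j, 0 < F j) ->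
  ln (\prod_(j < n) F j) = \sum_(j < n) ln (F j).
Proof.
move=> F0; elim: n F F0 => [|n IH] F F0; first by rewrite !big_ord0 ln1.
rewrite !big_ord_recl lnM ?posrE ?F0 //; last by rewrite prodr_gt0.
by rewrite IH.
Qed.

Lemma sum_natr_ord {R : realFieldType} (n : nat) :
  \sum_(j < n) (j%:R : R) = 'C(n, 2)%:R.
Proof. by rewrite -natr_sum -bin2_sum big_mkord. Qed.

(** The factor of index j divided by p is 1 + u_j, where u_j = (w sd - (1 -
    p) j) / (p (N - j)) is O(1 / n), so the logarithm is the sum of the u_j
    up to O(1 / n). Replacing N - j by N changes this sum by O(1 / n), and
    since the j sum to N it becomes w n sd / (p N) - (1 - p) / p. Here (1 -
    p) / p = beta ^ 2 / 2, and the square of n sd / (p N) is beta ^ 2 n / (n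
    - 1). *)
Lemma log_incl_prob_ratio {R : realType} (a A eps : R) :
  0 < a -> 0 <= A -> 0 < eps -> exists n0 : nat, forall n, (n0 <= n)%N ->
  forall (p : R) (m : nat) , a <= p <= 1 - a ->
  let N := 'C(n, 2) in let beta := Num.sqrt (2 * (1 - p) / p) in
  let w := standardize N p m in
  `|w| <= A ->
  0 < incl_prob N m n / p ^+ n :> R /\
  `|ln (incl_prob N m n / p ^+ n) + beta ^+ 2 / 2 - beta * w| <= eps.
Proof.
move=> a0 A0 eps0.
(* The first term of K makes the total error at most eps, the second one makes the
   bound U on the u_j at most 1 / 2. *)
pose K := 54 * (A + 1) ^+ 2 / (a ^+ 2 * eps) + 8 * (A + 1) / a.
have K1 : 0 <= 54 * (A + 1) ^+ 2 / (a ^+ 2 * eps).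
  by rewrite divr_ge0 // mulr_ge0 ?sqr_ge0 // ltW.
have K2 : 0 <= 8 * (A + 1) / a by rewrite divr_ge0 ?mulr_ge0 ?(ltW a0) //; lra.
exists (Num.bound K + 6)%N => n hn p m /andP[ap pa1] N beta w wA.
have n6 : 6 <= n%:R :> R by rewrite ler_nat (leq_trans _ hn) // leq_addl.
have Kn : K <= n%:R.
  rewrite ltW // (lt_le_trans (archi_boundP _)) ?addr_ge0 // ler_nat.
  by rewrite (leq_trans _ hn) // leq_addr.
have n0 : (0 < n)%N by rewrite -(ltr_nat R); lra.
have NE : N%:R = n%:R * (n%:R - 1) / 2 :> R by apply: natr_bin2.
have [p0 q0] : 0 < p /\ 0 < 1 - p by split; lra.
have nR0 : 0 < n%:R :> R by lra.
have N0 : 0 < N%:R :> R by rewrite NE divr_gt0 // mulr_gt0 //; lra.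
have Nn : n%:R ^+ 2 / 4 <= N%:R - n%:R :> R by rewrite NE; nra.
have n20 : 0 < n%:R ^+ 2 / 4 :> R by rewrite divr_gt0 // exprn_gt0.
have var0 : 0 < N%:R * p * (1 - p) by rewrite !mulr_gt0.
set sd := std_dev N p.
have sd0 : 0 < sd by rewrite sqrtr_gt0.
have sd2 : sd ^+ 2 = N%:R * p * (1 - p) by rewrite sqr_sqrtr // ltW.
have sdn : sd <= n%:R.
  rewrite -(@ler_pXn2r _ 2) ?nnegrE ?(ltW sd0) ?(ltW nR0) // sd2.
  apply: (@le_trans _ _ N%:R); last by rewrite NE; nra.
  by rewrite -mulrA ler_piMr ?(ltW N0) //; nra.
have mE : m%:R = N%:R * p + w * sd by rewrite /w /standardize divfK ?gt_eqF // addrC subrK.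
pose U := 4 * (A + 1) / (a * n%:R).
have U0 : 0 <= U by rewrite divr_ge0 ?mulr_ge0 ?(ltW a0) ?(ltW nR0) //; lra.
have Uhalf : U <= 1 / 2.
  rewrite /U ler_pdivrMr ?mulr_gt0 //.
  have : 8 * (A + 1) / a <= n%:R by apply: le_trans Kn; rewrite /K lerDr.
  by rewrite ler_pdivrMr //; lra.
pose num (j : nat) := w * sd - (1 - p) * j%:R.
pose u (j : nat) := num j / (p * (N%:R - j%:R)).
pose u0 (j : nat) := num j / (p * N%:R).
have jn (j : 'I_n) : 0 <= (j%:R : R) /\ (j%:R : R) <= n%:R.
  by split => //; rewrite ler_nat ltnW.
have numA j : (j < n)%N -> `|num j| <= (A + 1) * n%:R.
  move=> jn'; apply: (le_trans (ler_normB _ _)).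
  rewrite [leRHS]mulrDl mul1r lerD //.
    by rewrite normrM (gtr0_norm sd0) ler_pM // ltW.
  rewrite ger0_norm ?mulr_ge0 ?(ltW q0) //.
  have : (j%:R : R) <= n%:R by rewrite ler_nat ltnW.
  by move=> h; rewrite (le_trans _ h) // ler_piMl //; lra.
have uU (j : 'I_n) : `|u j| <= U.
  have [j1 j2] := jn j.
  have Nj : n%:R ^+ 2 / 4 <= N%:R - j%:R :> R by lra.
  have Nj0 : 0 < N%:R - (j%:R : R) by lra.
  rewrite /u normrM normfV [`|p * _|]gtr0_norm ?mulr_gt0 //.
  rewrite ler_pdivrMr ?mulr_gt0 //; apply: (le_trans (numA j (ltn_ord j))).
  have -> : (A + 1) * n%:R = U * (a * (n%:R ^+ 2 / 4)).
    by rewrite /U; field; rewrite !gt_eqF.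
  rewrite ler_wpM2l //; clear -a0 ap Nj n20; apply: ler_pM; lra.
have facE (j : 'I_n) : (m%:R - j%:R) / (N%:R - j%:R) / p = 1 + u j.
  have [j1 j2] := jn j.
  rewrite mE /u /num; field; rewrite !gt_eqF //; lra.
have fac0 (j : 'I_n) : 0 < 1 + u j.
  by have := uU j; rewrite ler_norml => /andP[h _]; lra.
have prodE : incl_prob N m n / p ^+ n = \prod_(j < n) (1 + u j).
  rewrite -[in p ^+ n](card_ord n) -prodr_const -prodf_div.
  by apply: eq_bigr => j _; exact: facE.
rewrite prodE; split; first by rewrite prodr_gt0.
rewrite ln_prod //.
have beta2 : beta ^+ 2 = 2 * (1 - p) / p.
  by rewrite sqr_sqrtr // divr_ge0 ?mulr_ge0 ?(ltW p0) ?(ltW q0).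
have beta0 : 0 <= beta by exact: sqrtr_ge0.
have ia : 1 <= 1 / a by rewrite ler_pdivlMr // mul1r; lra.
have ip : 1 / p <= 1 / a by rewrite !div1r lef_pV2.
have beta20 : 0 < beta ^+ 2 by rewrite beta2 divr_gt0 // mulr_gt0.
have betap : 0 < beta by rewrite lt_neqAle beta0 andbT eq_sym; move: beta20; rewrite exprn_even_gt0.
have beta3 : beta <= 3 / a.
  have h : beta ^+ 2 <= 2 / a.
    rewrite beta2 -mulrA ler_wpM2l // -[a^-1]div1r.
    by apply: le_trans ip; rewrite ler_wpM2r ?invr_ge0 ?(ltW p0) //; lra.
  have : 0 <= (beta - 1) ^+ 2 by rewrite sqr_ge0.
  nra.
(* g is beta * sqrt (n / (n - 1)). *)
pose g := n%:R * sd / (p * N%:R).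
have g0 : 0 <= g by rewrite divr_ge0 ?mulr_ge0 ?(ltW sd0) ?(ltW p0) ?(ltW N0).
have g2 : g ^+ 2 = beta ^+ 2 + beta ^+ 2 / (n%:R - 1).
  rewrite /g !exprMn exprVn sd2 beta2 NE; field.
  by rewrite !gt_eqF //; lra.
have gb : beta <= g.
  rewrite -(@ler_pXn2r _ 2) ?nnegrE // g2 lerDl divr_ge0 ?sqr_ge0 //; lra.
have gbn : g - beta <= beta / (n%:R - 1).
  rewrite -(@ler_pM2r _ beta) //.
  apply: (@le_trans _ _ (g ^+ 2 - beta ^+ 2)); first by nra.
  by rewrite g2 addrAC subrr add0r [leRHS]mulrAC -expr2.
have nbd : beta / (n%:R - 1) <= 6 / (a * n%:R).
  rewrite ler_pdivrMr; last lra.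
  apply: (le_trans beta3).
  have -> : 3 / a = 6 / (a * n%:R) * (n%:R / 2) by field; rewrite !gt_eqF.
  by rewrite ler_wpM2l ?divr_ge0 ?mulr_ge0 ?(ltW a0) ?(ltW nR0) //; lra.
pose D := (A + 1) ^+ 2 / (a ^+ 2 * n%:R).
have h4 : `|w * (g - beta)| <= 6 * D.
  rewrite normrM [`|g - beta|]ger0_norm ?subr_ge0 //.
  apply: (@le_trans _ _ ((A + 1) ^+ 2 * (6 / (a * n%:R) * (1 / a)))).
    apply: ler_pM => //; first by rewrite subr_ge0.
      by apply: (le_trans wA); rewrite expr2; clear -A0; nra.
    apply: (le_trans gbn); apply: (le_trans nbd).
    by rewrite ler_peMr // divr_ge0 // mulr_ge0 // ltW.
  by rewrite le_eqVlt; apply/orP; left; apply/eqP; rewrite /D; field; rewrite !gt_eqF.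
have UD : U <= 4 * D.
  apply: (@le_trans _ _ (4 * (A + 1) ^+ 2 / (a * n%:R) * (1 / a))); last first.
    by rewrite le_eqVlt; apply/orP; left; apply/eqP; rewrite /D; field; rewrite !gt_eqF.
  rewrite -[leLHS]mulr1; apply: ler_pM => //.
  by rewrite /U ler_wpM2r ?invr_ge0 ?mulr_ge0 ?(ltW a0) ?(ltW nR0) // expr2; clear -A0; nra.
have U2D : 2 * n%:R * U ^+ 2 = 32 * D.
  by rewrite /U /D; field; rewrite !gt_eqF.
have Deps : 54 * D <= eps.
  have h : 54 * (A + 1) ^+ 2 / (a ^+ 2 * eps) <= n%:R by apply: le_trans Kn; rewrite /K lerDl.
  rewrite ler_pdivrMr ?mulr_gt0 ?exprn_gt0 // in h.
  rewrite /D mulrA ler_pdivrMr ?mulr_gt0 ?exprn_gt0 //.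
  by have -> : eps * (a ^+ 2 * n%:R) = n%:R * (a ^+ 2 * eps) by ring.
have h1 : \sum_(j < n) u j - 32 * D <= \sum_(j < n) ln (1 + u j) <= \sum_(j < n) u j.
  apply/andP; split; last first.
    by apply: ler_sum => j _; have /andP[] := ln1D_bounds (le_trans (uU j) Uhalf).
  have -> : 32 * D = \sum_(j < n) 2 * U ^+ 2.
    by rewrite sumr_const card_ord -[RHS]mulr_natr -U2D; ring.
  rewrite -sumrB; apply: ler_sum => j _.
  have /andP[h _] := ln1D_bounds (le_trans (uU j) Uhalf); apply: le_trans h.
  rewrite lerB // ler_wpM2l // -[leLHS]real_normK ?num_real //.
  by rewrite lerXn2r ?nnegrE.
have h2 : `|\sum_(j < n) u j - \sum_(j < n) u0 j| <= 4 * U.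
  rewrite -sumrB; apply: (le_trans (ler_norm_sum _ _ _)).
  apply: (@le_trans _ _ (\sum_(j < n) U * (n%:R / N%:R))).
    apply: ler_sum => j _; have [j1 j2] := jn j.
    have -> : u j - u0 j = u j * (j%:R / N%:R).
      have Nj0 : 0 < N%:R - (j%:R : R) by clear -Nn n20 j2; lra.
      by rewrite /u /u0; field; rewrite !gt_eqF.
    rewrite normrM ler_pM // ger0_norm ?divr_ge0 ?(ltW N0) //.
    by rewrite ler_wpM2r // invr_ge0 ltW.
  rewrite sumr_const card_ord -[leLHS]mulr_natr.
  have -> : U * (n%:R / N%:R) * n%:R = U * (n%:R ^+ 2 / N%:R) by ring.
  rewrite [leRHS]mulrC ler_wpM2l // ler_pdivrMr // NE; clear -n6; nra.
have h3 : \sum_(j < n) u0 j = w * g - beta ^+ 2 / 2.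
  rewrite /u0 -mulr_suml /num sumrB sumr_const card_ord -[_ *+ n]mulr_natr.
  rewrite -mulr_sumr sum_natr_ord -/N beta2 /g; field.
  by rewrite !gt_eqF.
move/andP : h1 => [h1a h1b].
have wg : w * (g - beta) = w * g - w * beta by ring.
have wb : beta * w = w * beta by ring.
move: h2 h4; rewrite wg wb h3 !ler_norml.
move: (\sum_(j < n) u j) (\sum_(j < n) ln (1 + u j)) h1a h1b => s1 s2 h1a h1b.
move: (w * g) (w * beta) (beta ^+ 2 / 2) => x1 x2 x3.
clear -h1a h1b UD Deps => /andP[h2a h2b] /andP[h4a h4b].
by apply/andP; split; lra.
Qed.

(** * From G(n,m) to G(n,p) *)

Section finite_probability_facts.
Context {R : realType} {T : finType} (P : T -> R).
Hypothesis P0 : forall w, 0 <= P w.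

Lemma le_Pr_or (A B C : pred T) : (forall w, A w -> B w || C w) ->
  Pr P A <= Pr P B + Pr P C.
Proof.
move=> h; rewrite /Pr [leLHS]big_mkcond [X in X + _]big_mkcond [X in _ + X]big_mkcond.
rewrite -big_split /=; apply: ler_sum => w _; have := h w; have := P0 w.
case: (A w) => [Pw /(_ isT)|Pw _].
  by case: (B w) => [_|/= ->]; rewrite ?add0r // lerDl; case: ifP.
by rewrite addr_ge0 //; case: ifP.
Qed.

Lemma PrE (A : pred T) : Pr P A = \sum_w P w * (A w)%:R.
Proof.
by rewrite /Pr big_mkcond; apply: eq_bigr => w _; case: (A w); rewrite ?mulr1 ?mulr0.
Qed.

End finite_probability_facts.

(** Chebyshev's inequality for X / E X, whose variance is at most eta. *)
Lemma second_moment_method {R : realType} {T : finType} (P X : T -> R) (eta eps : R) :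
  is_dist P -> 0 < eps -> 0 < Ex P X ->
  Ex P (fun w => X w ^+ 2) <= (1 + eta) * Ex P X ^+ 2 ->
  Pr P [pred w | eps < `|X w / Ex P X - 1|] <= eta / eps ^+ 2.
Proof.
move=> [P0 P1] e0 mu0 h; apply: (le_trans (chebyshev_finite _ _ P0 e0)).
rewrite ler_wpM2r ?invr_ge0 ?sqr_ge0 //.
set mu := Ex P X in mu0 h *.
have -> : \sum_w P w * (X w / mu - 1) ^+ 2 = Ex P (fun w => X w ^+ 2) / mu ^+ 2 - 1.
  transitivity (\sum_w (P w * X w ^+ 2 / mu ^+ 2 - 2 / mu * (P w * X w) + P w)).
    by apply: eq_bigr => w _; field; rewrite gt_eqF.
  rewrite big_split /= sumrB -mulr_suml -mulr_sumr P1 -/(Ex P X) -/mu -/(Ex P _).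
  by field; rewrite gt_eqF.
by rewrite lerBlDr ler_pdivrMr ?exprn_gt0 // [eta + 1]addrC.
Qed.

Section gnp_edges.
Context {R : realType} {n : nat}.
Local Notation N := 'C(n, 2).

Lemma Pr_gnp_card (p : R) (A : pred nat) :
  Pr (@gnp R n p) [pred G : graph n | A #|G|] = \sum_(k < N.+1 | A k) binomial_pmf N p k.
Proof.
rewrite PrE [RHS]big_mkcond /=.
rewrite (@sum_bernoulli_set_card R (edge n) p (fun k => (A k)%:R)) card_edge.
by apply: eq_bigr => k _; case: (A k); rewrite ?mulr1 ?mulr0.
Qed.

(** G(n,p) is a mixture of the models G(n,m), so a bound that holds in all
    those with an admissible number of edges is inherited. *)
Lemma Pr_gnp_le_gnm (p c : R) (A : nat -> bool) (B : nat -> pred (graph n)) :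
  0 <= p <= 1 -> 0 <= c ->
  (forall m, (m <= N)%N -> A m -> Pr (@gnm R n m) (B m) <= c) ->
  Pr (@gnp R n p) [pred G : graph n | A #|G| && B #|G| G] <= c.
Proof.
move=> p01 c0 h; have [g0 g1] := @gnp_dist R n p p01.
rewrite PrE sum_gnp_by_edges.
apply: (@le_trans _ _ (\sum_(m < N.+1)
    (\sum_(H : graph n | #|H| == m) gnp p H) * c)); last first.
  rewrite -mulr_suml -[leRHS]mul1r ler_wpM2r //.
  have one m : (m <= N)%N -> \sum_(G : graph n) gnm m G * 1 = 1 :> R.
    by move=> /(@gnm_dist R n)[_ g]; under eq_bigr do rewrite mulr1.
  rewrite le_eqVlt; apply/orP; left; apply/eqP; rewrite -[RHS]g1.
  under [RHS]eq_bigr do rewrite -[gnp p _]mulr1.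
  rewrite (sum_gnp_by_edges p (fun=> 1)); apply: eq_bigr => m _.
  by rewrite one ?mulr1 // -ltnS.
apply: ler_sum => m _; rewrite ler_wpM2l ?sumr_ge0 //.
have mN : (m <= N)%N := ltn_ord m.
have [Am|nAm] := boolP (A m).
  apply: le_trans (h m mN Am); rewrite PrE; apply: ler_sum => G _.
  rewrite gnmE //; case: eqP => [Gm|_]; last by rewrite !mul0r.
  by rewrite /= Gm Am.
rewrite big1 // => G _; rewrite gnmE //; case: eqP => [Gm|_]; last by rewrite !mul0r.
by rewrite /= Gm (negbTE nAm) mulr0.
Qed.

End gnp_edges.

Lemma second_moment_dvd {R : realType} (a eta : R) :
  0 < a -> a <= 1 -> 0 < eta -> exists n1 : nat, forall n, (n1 <= n)%N -> (3 %| n)%N ->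
  forall m, (m <= 'C(n, 2))%N -> a * 'C(n, 2)%:R <= m%:R ->
  0 < Ex (@gnm R n m) (@X_ R n) /\
  Ex (@gnm R n m) (fun G => X_ G ^+ 2) <= (1 + eta) * Ex (@gnm R n m) (@X_ R n) ^+ 2.
Proof.
move=> a0 a1 e0; have [t1 h] := second_moment_uniform a0 a1 e0.
exists (3 * t1)%N => n nt /dvdnP[t nE]; move: nt; rewrite {n}nE [(t * 3)%N]mulnC.
by rewrite leq_pmul2l //; exact: h.
Qed.

Lemma gnm_concentration {R : realType} (a eps c : R) : 0 < a -> a <= 1 -> 0 < eps -> 0 < c ->
  exists n1 : nat, forall n, (n1 <= n)%N -> (3 %| n)%N ->
  forall m, (m <= 'C(n, 2))%N -> a * 'C(n, 2)%:R <= m%:R ->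
  0 < Ex (@gnm R n m) (@X_ R n) /\
  Pr (@gnm R n m) [pred G | eps < `|X_ G / Ex (@gnm R n m) (@X_ R n) - 1|] <= c.
Proof.
move=> a0 a1 e0 c0.
have eta0 : 0 < c * eps ^+ 2 by rewrite mulr_gt0 ?exprn_gt0.
have [n1 h] := second_moment_dvd a0 a1 eta0.
exists n1 => n nn1 n3 m mN am; have [mu0 h2] := h n nn1 n3 m mN am.
split => //; apply: le_trans (second_moment_method (gnm_dist R mN) e0 mu0 h2) _.
by rewrite mulfK // expf_neq0 // gt_eqF.
Qed.

(** Both means are the number of triple partitions times the probability that
    a given one is present. *)
Lemma mean_ratio {R : realType} (n m : nat) (p : R) : (3 %| n)%N -> (m <= 'C(n, 2))%N ->
  0 < p -> 0 < Ex (@gnp R n p) (@X_ R n) /\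
  Ex (@gnm R n m) (@X_ R n) / Ex (@gnp R n p) (@X_ R n) =
    incl_prob 'C(n, 2) m n / p ^+ n.
Proof.
move=> /dvdnP[t ->]; rewrite [(t * 3)%N]mulnC => mN p0.
rewrite mean_gnm_X // mean_gnp_X card_triple_partitions_setT.
have D0 : 0 < (triple_partition_number t)%:R :> R.
  by rewrite ltr0n triple_partition_number_gt0.
split; first by rewrite mulr_gt0 ?exprn_gt0.
by rewrite invfM mulrACA divff ?mul1r // gt_eqF.
Qed.

(** The logarithm is the sum of ln(X / mu), at most 2 e1 in absolute value,
    and of ln(mu / lambda) + beta ^ 2 / 2, which is within e2 of beta w. *)
Lemma lne_ratio_close {R : realType} (X mu lambda beta w e1 e2 d : R) :
  0 < mu -> 0 < lambda -> 0 < beta -> e1 <= 1 / 2 -> `|X / mu - 1| <= e1 ->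
  `|ln (mu / lambda) + beta ^+ 2 / 2 - beta * w| <= e2 -> 2 * e1 + e2 <= d * beta ->
  exists2 y : R, (lne (expR (beta ^+ 2 / 2) * X / lambda)%:E / beta%:E)%E = y%:E &
    `|y - w| <= d.
Proof.
move=> mu0 l0 b0 e12 hX hm he.
have := le_trans hX e12; rewrite ler_norml => /andP[hX1 hX2].
have Xmu0 : 0 < X / mu by lra.
have ml0 : 0 < mu / lambda by rewrite divr_gt0.
have E : expR (beta ^+ 2 / 2) * X / lambda = expR (beta ^+ 2 / 2) * ((X / mu) * (mu / lambda)).
  by field; rewrite !gt_eqF.
have P0 : 0 < X / mu * (mu / lambda) by exact: mulr_gt0.
have e0 : 0 < expR (beta ^+ 2 / 2) by exact: expR_gt0.
exists ((beta ^+ 2 / 2 + (ln (X / mu) + ln (mu / lambda))) / beta).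
  rewrite E lne_EFin; last exact: mulr_gt0.
  by rewrite inver gt_eqF // -EFinM lnM // expRK lnM.
have -> : (beta ^+ 2 / 2 + (ln (X / mu) + ln (mu / lambda))) / beta - w =
    (ln (X / mu) + (ln (mu / lambda) + beta ^+ 2 / 2 - beta * w)) / beta.
  by field; rewrite gt_eqF.
rewrite normrM normfV (gtr0_norm b0) ler_pdivrMr //; apply: le_trans he.
apply: (le_trans (ler_normD _ _)); rewrite lerD //.
have hv := ln1D_bounds (le_trans hX e12).
have e1X : 1 + (X / mu - 1) = X / mu by ring.
rewrite e1X in hv; move: hv => /andP[hv1 hv2].
have hXX : (X / mu - 1) ^+ 2 <= e1 * (1 / 2).
  rewrite -real_normK ?num_real // expr2 ler_pM // (le_trans hX) //.
move: hX; rewrite !ler_norml => /andP[g1 g2].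
by apply/andP; split; lra.
Qed.

Lemma normal_cdf_lipschitz {R : realType} (x y : R) : x <= y ->
  normal_cdf y - normal_cdf x <= normal_peak 1 * (y - x).
Proof.
move=> xy; have bnd z : x <= z <= y -> (0 : R) <= normal_pdf 0 1 z <= normal_peak 1.
  by move=> _; rewrite normal_pdf_ge0 normal_pdf_ub // oner_neq0.
by have /andP[] := normal_cdf_sub_bounds xy (lexx 0) bnd.
Qed.

Definition log_factors {R : realType} (n : nat) (p : R) (G : graph n) : \bar R :=
  let beta := Num.sqrt (2 * (1 - p) / p) in
  (lne (expR (beta ^+ 2 / 2) * X_ G / Ex (@gnp R n p) (@X_ R n))%:E / beta%:E)%E.

(** Outside the exceptional event the number of edges is within A standard
    deviations of its mean, and X is close to its mean given the number of
    edges; then log_incl_prob_ratio gives the logarithm of that conditional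
    mean. *)
Lemma log_factors_close_to_edges {R : realType} (a d c : R) :
  0 < a -> a <= 1 / 2 -> 0 < d -> 0 < c -> exists n0 : nat,
  forall n, (n0 <= n)%N -> (3 %| n)%N -> forall p, a <= p <= 1 - a ->
  exists bad : pred (graph n), Pr (@gnp R n p) bad <= c /\
  forall G, ~~ bad G ->
    exists2 y : R, log_factors p G = y%:E & `|y - standardize 'C(n, 2) p (#|G|)%N| <= d.
Proof.
move=> a0 a2 d0 c0.
pose b0 : R := Num.sqrt (2 * a).
have b00 : 0 < b0 by rewrite sqrtr_gt0 mulr_gt0.
have db0 : 0 < d * b0 by rewrite mulr_gt0.
have [e1 [e10 e12 e1d]] : exists e1 : R, [/\ 0 < e1, e1 <= 1 / 2 & e1 <= d * b0 / 4].
  exists (Num.min (1 / 2) (d * b0 / 4)); split.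
  - by rewrite lt_min !divr_gt0.
  - by rewrite ge_min lexx.
  - by rewrite ge_min lexx orbT.
have e20 : 0 < d * b0 / 2 by rewrite divr_gt0.
have c20 : 0 < c / 2 by rewrite divr_gt0.
pose A := 1 + 2 / c.
have ic0 : 0 < 2 / c by rewrite divr_gt0.
have A1 : 1 <= A by rewrite /A; lra.
have Ac : 1 / A ^+ 2 <= c / 2.
  rewrite ler_pdivrMr ?exprn_gt0 //; last lra.
  have h : 1 <= c / 2 * A by rewrite /A mulrDr mulr1 mulf_div [2 * c]mulrC divff ?mulf_neq0 ?gt_eqF //; lra.
  by rewrite expr2 mulrA (le_trans h) // ler_peMr // (le_trans _ h).
have a20 : 0 < a / 2 by rewrite divr_gt0.
have a21 : a / 2 <= 1 by lra.
have [n1 h1] := gnm_concentration a20 a21 e10 c20.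
have [n2 h2] := log_incl_prob_ratio a0 (le_trans ler01 A1) e20.
(* For N >= K the deviation A * sqrt N is at most a N / 2, which keeps the number of
   edges above a N / 2. *)
pose K := (2 * A / a) ^+ 2.
exists (n1 + n2 + (Num.bound K).+2)%N => n nn n3 p pa; pose beta := Num.sqrt (2 * (1 - p) / p).
have /andP[ap pa1] := pa.
have [p0 q0] : 0 < p /\ 0 < 1 - p by split; lra.
have p01 : 0 <= p <= 1 by rewrite (ltW p0) -subr_ge0 (ltW q0).
have nn1 : (n1 <= n)%N by rewrite (leq_trans _ nn) // -addnA leq_addr.
have nn2 : (n2 <= n)%N by rewrite (leq_trans _ nn) // addnAC leq_addl.
have nK : ((Num.bound K).+2 <= n)%N by rewrite (leq_trans _ nn) // leq_addl.
have n0 : (0 < n)%N by rewrite (leq_trans _ nK).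
have KN : K <= 'C(n, 2)%:R.
  have n2R : 2 <= n%:R :> R by rewrite ler_nat (leq_trans _ nK).
  have nKR : (Num.bound K)%:R + 1 <= n%:R :> R by rewrite natr1 ler_nat ltnW.
  have hK := archi_boundP (sqr_ge0 (2 * A / a)); rewrite -/K in hK.
  rewrite natr_bin2 //; nra.
set N := 'C(n, 2) in KN *.
have N0 : 0 < N%:R :> R by apply: lt_le_trans KN; rewrite exprn_gt0 // divr_gt0 ?mulr_gt0 //; lra.
have sd0 : 0 < std_dev N p by rewrite sqrtr_gt0 !mulr_gt0.
have b0beta : b0 <= beta.
  rewrite ler_wsqrtr // -mulrA ler_wpM2l // ler_pdivlMr //.
  by clear -a0 a2 ap pa1 p0; rewrite -[leRHS]mulr1 ler_pM //; lra.
have beta0 : 0 < beta by exact: lt_le_trans b0beta.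
have sNK : 2 * A / a <= Num.sqrt N%:R.
  have -> : 2 * A / a = Num.sqrt K by rewrite sqrtr_sqr ger0_norm // divr_ge0 ?mulr_ge0 ?(ltW a0) //; lra.
  exact: ler_wsqrtr.
have sN2 : Num.sqrt N%:R ^+ 2 = N%:R :> R by rewrite sqr_sqrtr // ltW.
have sdN : std_dev N p <= Num.sqrt N%:R.
  rewrite ler_wsqrtr // -mulrA ler_piMr ?(ltW N0) //.
  by clear -a0 ap pa1 p0 q0; rewrite mulr_ile1 ?(ltW p0) ?(ltW q0) //; lra.
have AsN : A * std_dev N p <= a / 2 * N%:R.
  apply: (@le_trans _ _ (A * Num.sqrt N%:R)); first by rewrite ler_wpM2l //; lra.
  rewrite -[X in _ <= _ * X]sN2 expr2 mulrA ler_wpM2r ?sqrtr_ge0 //.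
  by move: sNK; clear -a0; rewrite ler_pdivrMr //; lra.
have window m : `|standardize N p m| <= A -> a / 2 * N%:R <= m%:R.
  rewrite ler_norml => /andP[hm _].
  rewrite /standardize ler_pdivlMr // in hm.
  have : a * N%:R <= N%:R * p by rewrite mulrC ler_wpM2l ?(ltW N0).
  lra.
pose far (G : graph n) := A <= `|standardize N p #|G| |.
pose mu m := Ex (@gnm R n m) (@X_ R n).
pose off (G : graph n) := (`|standardize N p #|G| | <= A) && (e1 < `|X_ G / mu #|G| - 1|).
exists [pred G | far G || off G]; split.
  have [g0 _] := @gnp_dist R n p p01.
  have -> : c = c / 2 + c / 2 by field.
  apply: le_trans (@le_Pr_or _ _ _ g0 _ far off _) _; first by [].
  apply: lerD.
    apply: le_trans Ac.
    rewrite (@Pr_gnp_card R n p (fun k => A <= `|standardize N p k|)).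
    by apply: binomial_chebyshev => //; exact: lt_le_trans ltr01 A1.
  apply: (@Pr_gnp_le_gnm R n p (c / 2) (fun m => `|standardize N p m| <= A)
     (fun m G => e1 < `|X_ G / mu m - 1|)) => // [|m mN /window am].
    exact: ltW.
  by have [_] := h1 n nn1 n3 m mN am.
move=> G; rewrite /= negb_or negb_and -ltNge -leNgt => /andP[nf noff].
have wA : `|standardize N p #|G| | <= A by exact: ltW.
have {noff} hX : `|X_ G / mu #|G| - 1| <= e1.
  by move: noff; rewrite wA.
have GN : (#|G| <= N)%N by rewrite /N -(card_edge n) max_card.
have [mu0 _] := h1 n nn1 n3 _ GN (window _ wA).
have [l0 ratio] := mean_ratio n3 GN p0.
have [_ hr] := h2 n nn2 p #|G| pa wA.
rewrite -ratio in hr.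
apply: (lne_ratio_close mu0 l0 beta0 e12 hX hr).
have : d * b0 <= d * beta by rewrite ler_wpM2l // ltW.
by clear -e1d; lra.
Qed.

(** By log_factors_close_to_edges the distribution function of log_factors
    lies, up to a small error, between those of the standardized number of
    edges at x - d and at x + d. *)
Lemma gnp_log_clt {R : realType} (a x e : R) : 0 < a -> a <= 1 / 2 -> 0 < e ->
  exists n0 : nat, forall n, (n0 <= n)%N -> (3 %| n)%N -> forall p, a <= p <= 1 - a ->
  `|Pr (@gnp R n p) [pred G | (log_factors p G <= x%:E)%E] - normal_cdf x| <= e.
Proof.
move=> a0 a2 e0.
pose c := normal_peak 1 : R.
have c0 : 0 <= c := normal_peak_ge0 1.
pose d := e / (2 * (2 * c + 1)).
have c1 : 0 < 2 * (2 * c + 1) by lra.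
have d0 : 0 < d by rewrite divr_gt0.
have dE : 2 * (2 * (c * d)) + 2 * d = e.
  have -> : 2 * (2 * (c * d)) + 2 * d = 2 * (2 * c + 1) * d by ring.
  by rewrite /d mulrC divfK // gt_eqF.
have e20 : 0 < e / 2 by rewrite divr_gt0.
have [n1 h1] := log_factors_close_to_edges a0 a2 d0 e20.
have [N1 hN1] := de_moivre_laplace (x - d) a0 d0.
have [N2 hN2] := de_moivre_laplace (x + d) a0 d0.
exists (n1 + (N1 + N2).+2)%N => n nn n3 p pa.
have nn1 : (n1 <= n)%N by rewrite (leq_trans _ nn) // leq_addr.
have nN : ((N1 + N2).+2 <= n)%N by rewrite (leq_trans _ nn) // leq_addl.
have NN : (N1 + N2 <= 'C(n, 2))%N.
  rewrite -(ler_nat R) natr_bin2 ?(leq_trans _ nN) //.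
  have n2R : 2 <= n%:R :> R by rewrite ler_nat (leq_trans _ nN).
  have nKR : (N1 + N2)%:R + 1 <= n%:R :> R by rewrite natr1 ler_nat ltnW.
  nra.
have := hN1 _ (leq_trans (leq_addr _ _) NN) p pa.
have := hN2 _ (leq_trans (leq_addl _ _) NN) p pa.
have [bad [hbad hgood]] := h1 n nn1 n3 p pa.
have p01 : 0 <= p <= 1 by move: pa => /andP[? ?]; apply/andP; split; lra.
have p0 : 0 < p by move: pa => /andP[? ?]; lra.
have q0 : 0 < 1 - p by move: pa => /andP[? ?]; lra.
have N0 : (0 < 'C(n, 2))%N by rewrite bin_gt0 (leq_trans _ nN).
have sd0 : 0 < std_dev 'C(n, 2) p by rewrite sqrtr_gt0 !mulr_gt0 // ltr0n.
have [g0 _] := @gnp_dist R n p p01.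
have W y : \sum_(k < 'C(n, 2).+1 | k%:R <= 'C(n, 2)%:R * p + y * std_dev 'C(n, 2) p)
      binomial_pmf 'C(n, 2) p k
    = Pr (@gnp R n p) [pred G : graph n | standardize 'C(n, 2) p #|G| <= y].
  rewrite (@Pr_gnp_card R n p (fun k => standardize 'C(n, 2) p k <= y)).
  by apply: eq_bigl => k; rewrite standardize_le.
rewrite !W => /andP[_ up] /andP[lo _].
have up' : Pr (@gnp R n p) [pred G | (log_factors p G <= x%:E)%E] <=
    Pr (@gnp R n p) [pred G : graph n | standardize 'C(n, 2) p #|G| <= x + d] + e / 2.
  apply: le_trans (lerD (lexx _) hbad); apply: (le_Pr_or g0) => G /= YG.
  have [//|/hgood[y Yy /ler_normlP[h _]]] := boolP (bad G); first by rewrite orbT.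
  move: YG; rewrite Yy lee_fin => yx.
  by apply/orP; left; clear -h yx; lra.
have lo' : Pr (@gnp R n p) [pred G : graph n | standardize 'C(n, 2) p #|G| <= x - d] <=
    Pr (@gnp R n p) [pred G | (log_factors p G <= x%:E)%E] + e / 2.
  apply: le_trans (lerD (lexx _) hbad); apply: (le_Pr_or g0) => G /= wx.
  have [//|/hgood[y Yy /ler_normlP[_ h]]] := boolP (bad G); first by rewrite orbT.
  rewrite Yy lee_fin.
  by apply/orP; left; clear -h wx; lra.
have xd : x <= x + d + d by lra.
have xd' : x - d - d <= x by lra.
have l1 : normal_cdf (x + d + d) - normal_cdf x <= 2 * (c * d).
  apply: (le_trans (normal_cdf_lipschitz xd)); rewrite -/c le_eqVlt; apply/orP; left; apply/eqP; ring.
have l2 : normal_cdf x - normal_cdf (x - d - d) <= 2 * (c * d).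
  apply: (le_trans (normal_cdf_lipschitz xd')); rewrite -/c le_eqVlt; apply/orP; left; apply/eqP; ring.
clear W h1 hgood hN1 hN2; rewrite ler_norml.
by apply/andP; split; lra.
Qed.

Lemma near_mult3P (Q : nat -> Prop) :
  (exists n0 : nat, forall n, (n0 <= n)%N -> (0 < n)%N -> (3 %| n)%N -> Q n) ->
  \forall n \near mult3_oo, Q n.
Proof.
move=> [n0 h]; rewrite /mult3_oo near_withinE; exists n0.+1 => // n /= nn n3.
by apply: h => //; [exact: ltnW|exact: leq_trans nn].
Qed.

Lemma near_mult3_exists (Q : nat -> Prop) : (\forall n \near mult3_oo, Q n) ->
  exists n0 : nat, forall n, (n0 <= n)%N -> (3 %| n)%N -> Q n.
Proof.
rewrite /mult3_oo near_withinE => -[n0 _ h].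
by exists n0 => n nn n3; exact: (h n).
Qed.

Lemma limf_einf_gt0 {R : realType} (f : nat -> R) (F : set_system nat) {FF : Filter F} :
  (0 < limf_einf (fun n => (f n)%:E) F)%E -> exists2 a : R, 0 < a & \forall n \near F, a <= f n.
Proof.
rewrite limf_einfE => /ereal_sup_gt[_ [V FV <-]] h.
have [a a0 ah] : exists2 a : R, 0 < a & (a%:E <= ereal_inf [set (f n)%:E | n in V])%E.
  case: (ereal_inf _) h => [r r0|_|//]; last by exists 1; rewrite ?leey.
  by exists r; rewrite -?lte_fin.
exists a => //; apply: filterS FV => n Vn; rewrite -lee_fin (le_trans ah) //.
by apply: ereal_inf_lbound; exists n.
Qed.

Lemma limf_esup_lt1 {R : realType} (f : nat -> R) (F : set_system nat) {FF : Filter F} :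
  (limf_esup (fun n => (f n)%:E) F < 1)%E ->
  exists2 a : R, 0 < a & \forall n \near F, f n <= 1 - a.
Proof.
rewrite limf_esupE => /ereal_inf_lt[_ [V FV <-]] h.
have [a a0 ah] : exists2 a : R, 0 < a & (ereal_sup [set (f n)%:E | n in V] <= (1 - a)%:E)%E.
  case: (ereal_sup _) h => [r r0|//|_]; last by exists 1; rewrite ?leNye.
  by exists (1 - r); rewrite ?subr_gt0 -?lte_fin // opprB addrC subrK.
exists a => //; apply: filterS FV => n Vn; rewrite -lee_fin (le_trans _ ah) //.
by apply: ereal_sup_ubound; exists n.
Qed.

Theorem theorem11 (R : realType) (p : nat -> R) (m : nat -> nat)
    (hp : forall n : nat, (0 < n)%N -> (3 %| n)%N -> 0 < p n < 1)
    (hm : forall n : nat, (0 < n)%N -> (3 %| n)%N -> (0 < m n < 'C(n, 2))%N)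
    (hmp : forall n : nat, (0 < n)%N -> (3 %| n)%N ->
      (m n)%:R = p n * ('C(n, 2))%:R)
    (hliminf : (0 < limf_einf (fun n => (p n)%:E) mult3_oo)%E) :
  cvg_in_prob mult3_oo (fun n => @gnm R n (m n))
    (fun n G => X_ G / mu_ R m n) 1
  /\
  ((limf_esup (fun n => (p n)%:E) mult3_oo < 1)%E ->
   cvg_in_dist mult3_oo (fun n => @gnp R n (p n))
    (fun n G =>
      lne (expR (beta_ p n ^+ 2 / 2) * X_ G / lambda_ p n)%R%:E / (beta_ p n)%:E)%E
    (normal_prob 0 1)).
Proof.
have [a a0 /near_mult3_exists[n1 an]] := limf_einf_gt0 hliminf.
split.
  move=> eps eps0; apply/cvgrPdist_le => c c0; apply: near_mult3P.
  pose b := Num.min a 1.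
  have b0 : 0 < b by rewrite lt_min a0 ltr01.
  have b1 : b <= 1 by rewrite ge_min lexx orbT.
  have [n2 h] := gnm_concentration b0 b1 eps0 c0.
  exists (n1 + n2)%N => n nn n0 n3.
  have nn1 : (n1 <= n)%N by rewrite (leq_trans _ nn) // leq_addr.
  have nn2 : (n2 <= n)%N by rewrite (leq_trans _ nn) // leq_addl.
  have /andP[_ mN] := hm n n0 n3.
  have bm : b * 'C(n, 2)%:R <= (m n)%:R.
    rewrite hmp // ler_wpM2r // (le_trans _ (an n nn1 n3)) //.
    by rewrite ge_min lexx.
  have [_ hc] := h n nn2 n3 (m n) (ltnW mN) bm.
  by rewrite sub0r normrN ger0_norm // /Pr sumr_ge0 // => G _; have [] := gnm_dist R (ltnW mN).
move=> hlimsup x _.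
have [b b0 /near_mult3_exists[n2 bn]] := limf_esup_lt1 hlimsup.
rewrite [X in _ --> X](normal_probE x); apply: cvg_EFin; first exact: nearW.
apply/cvgrPdist_le => c c0; apply: near_mult3P.
pose d := Num.min (Num.min a b) (1 / 2).
have d0 : 0 < d by rewrite !lt_min a0 b0 divr_gt0.
have d2 : d <= 1 / 2 by rewrite ge_min lexx orbT.
have da : d <= a by rewrite !ge_min lexx.
have db : d <= b by rewrite !ge_min lexx orbT.
have [n3 h] := gnp_log_clt x d0 d2 c0.
exists (n1 + n2 + n3)%N => n nn n0 n3'.
have nn1 : (n1 <= n)%N by rewrite (leq_trans _ nn) // -addnA leq_addr.
have nn2 : (n2 <= n)%N by rewrite (leq_trans _ nn) // addnAC leq_addl.
have nn3 : (n3 <= n)%N by rewrite (leq_trans _ nn) // leq_addl.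
have dp : d <= p n <= 1 - d.
  have := an n nn1 n3'; have := bn n nn2 n3' => ? ?.
  by apply/andP; split; lra.
by rewrite distrC; exact: (h n nn3 n3' (p n) dp).
Qed.
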